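(* A subset $\mathcal C\subseteq\mathcal M_*$ is relatively compact under the metric $d_{GHP}$ if and only if for each $r\ge0$ the set $\mathcal C_r:=\{\overline B_r(\mathcal X):\mathcal X\in\mathcal C\}$ (of GHP-isometry classes of compact pmm spaces) is relatively compact under the metric $d^c_{GHP}$.
   Context: A pointed measured metric (pmm) space is $\mathcal X=(X,o,\mu)$ with $X$ a metric space, $o\in X$, $\mu$ a nonnegative Borel measure; compact if $X$ compact and $\mu$ finite; boundedly compact if closed balls $\overline B_r(x)$ are compact and of finite measure. $\overline B_r(\mathcal X):=(\overline B_r(o),o,\mu|_{\overline B_r(o)})$. GHP-isometry: surjective distance-preserving map preserving base points and pushing the measure forward to the other measure. $\mathcal M_*$: GHP-isometry classes of boundedly compact pmm spaces; the set of classes of compact ones is denoted $\mathcal M^c_*$. $d_H$ Hausdorff distance; $d_P$ Prokhorov distance ($d_P(\mu,\nu)=\inf\{\epsilon>0:\mu(A)\le\nu(A^\epsilon)+\epsilon,\ \nu(A)\le\mu(A^\epsilon)+\epsilon\ \forall A\text{ closed}\}$). For compact pmm spaces $d^c_{GHP}(\mathcal X,\mathcal Y)=\inf\{d(f(o_X),g(o_Y))\vee d_H(f(X),g(Y))\vee d_P(f_*\mu_X,g_*\mu_Y)\}$ over metric spaces $Z$ and isometric embeddings $f,g$; it is a metric on $\mathcal M^c_*$. $\mathcal X'\preceq\mathcal X$ means $X'\subseteq X$, same base point, $\mu'\le\mu$. For $r\ge\epsilon\ge0$, $a(\epsilon,r;\mathcal X,\mathcal Y):=\inf d^c_{GHP}(\overline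 B_r(\mathcal X),\mathcal Y')$ over compact pmm-subspaces $\mathcal Y'$ with $\overline B_{r-\epsilon}(\mathcal Y)\preceq\mathcal Y'\preceq\mathcal Y$; $a_\epsilon:=a(\epsilon,1/\epsilon;\cdot,\cdot)$; $d_{GHP}(\mathcal X,\mathcal Y):=\inf\{\epsilon\in(0,1]:a_\epsilon(\mathcal X,\mathcal Y)\vee a_\epsilon(\mathcal Y,\mathcal X)<\epsilon/2\}$, $\inf\emptyset:=1$; this is a metric on $\mathcal M_*$. A subset is relatively compact if every sequence in it has a subsequence converging in the ambient space. *)

(* Defs.v *)
From HB Require Import structures.
From mathcomp Require Import all_boot all_order all_algebra.
From mathcomp Require Import all_classical all_reals all_analysis.
Set Implicit Arguments. Unset Strict Implicit. Unset Printing Implicit Defensive.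
Import Order.TTheory GRing.Theory Num.Theory.
Local Open Scope classical_set_scope.
Local Open Scope ring_scope.

Section GHP.
Variable R : realType.

Record mspace := MSpace { mcar : Type; mdst : mcar -> mcar -> R }.

Definition is_metric_on (T : Type) (D : set T) (d : T -> T -> R) : Prop :=
  forall x y z, D x -> D y -> D z ->
    (d x y = 0 <-> x = y) /\ d x y = d y x /\ d x z <= d x y + d y z.

Definition is_metric (Z : mspace) : Prop := is_metric_on setT (@mdst Z).

Definition nbhd_eps (Z : mspace) (A : set (mcar Z)) (e : R) : set (mcar Z) :=
  [set z | exists2 a, A a & mdst z a < e].

Definition mclosed (Z : mspace) (A : set (mcar Z)) : Prop :=
  forall z, (forall e, 0 < e -> exists2 a, A a & mdst z a < e) -> A z.

Definition dH (Z : mspace) (A B : set (mcar Z)) : \bar R :=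
  ereal_inf [set (e%:E)%E | e in
    [set e : R | 0 < e /\ A `<=` nbhd_eps B e /\ B `<=` nbhd_eps A e]].

Definition dP (Z : mspace) (mu nu : set (mcar Z) -> \bar R) : \bar R :=
  ereal_inf [set (e%:E)%E | e in
    [set e : R | 0 < e /\ forall A, mclosed A ->
       (mu A <= nu (nbhd_eps A e) + e%:E)%E /\
       (nu A <= mu (nbhd_eps A e) + e%:E)%E]].

(* ---------- pointed measured metric spaces ----------
   A pmm space is given by a carrier type [car], the underlying set
   [dom] (the space X itself), a distance [dst] (a metric on [dom]),
   a base point [bpt] and a measure [msr] on the Borel subsets of [dom]. *)
Record pmm := PMM { car : Type; dom : set car; dst : car -> car -> R;
                    bpt : car; msr : set car -> \bar R }.
Arguments dom : clear implicits.
Arguments msr : clear implicits.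

Definition open_in (T : Type) (D : set T) (d : T -> T -> R) (A : set T) : Prop :=
  A `<=` D /\
  forall x, A x -> exists2 e, 0 < e & forall y, D y -> d x y < e -> A y.

Definition borel_on (T : Type) (D : set T) (d : T -> T -> R) : set (set T) :=
  <<s D, open_in D d >>.

Definition is_borel_measure (T : Type) (D : set T) (d : T -> T -> R)
    (m : set T -> \bar R) : Prop :=
  m set0 = 0%E /\
  (forall A, borel_on D d A -> (0 <= m A)%E) /\
  (forall F : (set T)^nat, (forall n, borel_on D d (F n)) -> trivIset setT F ->
     (fun n => \sum_(0 <= i < n) m (F i))%E @ \oo --> m (\bigcup_n F n)).

Definition pmm_ok (X : pmm) : Prop :=
  is_metric_on (dom X) (@dst X) /\ dom X (bpt X) /\
  is_borel_measure (dom X) (@dst X) (@msr X).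

Definition compact_in (T : Type) (D : set T) (d : T -> T -> R) (K : set T) : Prop :=
  K `<=` D /\
  forall (I : Type) (U : I -> set T), (forall i, open_in D d (U i)) ->
    K `<=` \bigcup_i U i ->
    exists2 F : set I, finite_set F & K `<=` \bigcup_(i in F) U i.

Definition closed_ball (X : pmm) (x : car X) (r : R) : set (car X) :=
  [set y | dom X y /\ dst x y <= r].

Definition compact_pmm (X : pmm) : Prop :=
  pmm_ok X /\ compact_in (dom X) (@dst X) (dom X) /\ (msr X (dom X) < +oo)%E.

Definition bcompact_pmm (X : pmm) : Prop :=
  pmm_ok X /\
  forall x r, dom X x ->
    compact_in (dom X) (@dst X) (closed_ball x r) /\
    (msr X (closed_ball x r) < +oo)%E.

Definition sub_pmm (X : pmm) (D : set (car X)) (m : set (car X) -> \bar R) : pmm :=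
  PMM D (@dst X) (bpt X) m.

Definition ball_pmm (X : pmm) (r : R) : pmm :=
  sub_pmm (closed_ball (bpt X) r) (fun A => msr X (A `&` closed_ball (bpt X) r)).

(* (D1,m1) ≼ (D2,m2) as pmm-subspaces of X (same base point, same metric):
   D1 ⊆ D2 and m1 <= m2 on Borel sets of D1 *)
Definition pmm_le (X : pmm) (D1 : set (car X)) (m1 : set (car X) -> \bar R)
    (D2 : set (car X)) (m2 : set (car X) -> \bar R) : Prop :=
  D1 `<=` D2 /\ forall A, borel_on D1 (@dst X) A -> (m1 A <= m2 A)%E.

Definition isom_emb (X : pmm) (Z : mspace) (f : car X -> mcar Z) : Prop :=
  forall x y, dom X x -> dom X y -> mdst (f x) (f y) = dst x y.

Definition pushf (X : pmm) (Z : mspace) (f : car X -> mcar Z) : set (mcar Z) -> \bar R :=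
  fun A => msr X (dom X `&` f @^-1` A).

Definition dGHPc (X Y : pmm) : \bar R :=
  ereal_inf [set e | exists (Z : mspace) (f : car X -> mcar Z) (g : car Y -> mcar Z),
    [/\ is_metric Z, isom_emb f, isom_emb g &
     e = Order.max (mdst (f (bpt X)) (g (bpt Y)))%:E
           (Order.max (dH (f @` dom X) (g @` dom Y)) (dP (pushf f) (pushf g)))]].

Definition a_fun (eps r : R) (X Y : pmm) : \bar R :=
  ereal_inf [set e | exists (D : set (car Y)) (m : set (car Y) -> \bar R),
    [/\ compact_pmm (sub_pmm D m),
        pmm_le (closed_ball (bpt Y) (r - eps))
               (fun A => msr Y (A `&` closed_ball (bpt Y) (r - eps))) D m,
        pmm_le D m (dom Y) (msr Y) &
        e = dGHPc (ball_pmm X r) (sub_pmm D m)]].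

Definition a_eps (eps : R) (X Y : pmm) : \bar R := a_fun eps eps^-1 X Y.

(* d_GHP, with inf set0 := 1 *)
Definition dGHP (X Y : pmm) : \bar R :=
  Order.min 1%E (ereal_inf [set (e%:E)%E | e in
    [set e : R | 0 < e <= 1 /\
       (Order.max (a_eps e X Y) (a_eps e Y X) < (e / 2)%:E)%E]]).

Definition relcompact_GHP (C : set pmm) : Prop :=
  forall u : nat -> pmm, (forall n, C (u n)) ->
  exists (phi : nat -> nat) (L : pmm),
    [/\ {homo phi : m n / (m < n)%N >-> (m < n)%N}, bcompact_pmm L &
        (fun n => dGHP (u (phi n)) L) @ \oo --> 0%E].

Definition relcompact_GHPc (C : set pmm) : Prop :=
  forall u : nat -> pmm, (forall n, C (u n)) ->
  exists (phi : nat -> nat) (L : pmm),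
    [/\ {homo phi : m n / (m < n)%N >-> (m < n)%N}, compact_pmm L &
        (fun n => dGHPc (u (phi n)) L) @ \oo --> 0%E].

End GHP.

(* Main.v *)
Require Import Defs.
From HB Require Import structures.
From mathcomp Require Import all_boot all_order all_algebra.
From mathcomp Require Import all_classical all_reals all_analysis.
From mathcomp Require Import lra.
Import Defs.
Set Implicit Arguments. Unset Strict Implicit. Unset Printing Implicit Defensive.
Import Order.TTheory GRing.Theory Num.Theory.
Local Open Scope classical_set_scope.
Local Open Scope ring_scope.

(** Either hypothesis forces, by extracting a convergent subsequence from a
putative counterexample, uniform bounds over [C]: for all [r] and [e] a number
[N] such that every [r]-ball has an [e]-net of [N] points and mass at most [N].

Conversely, let [X n] satisfy such bounds and let [U] be a free ultrafilter on
[nat]. Bounded sequences of points, with the [U]-limit of the distances and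
modulo distance zero, form a boundedly compact space [upmm], whose measure is
the push-forward of the Loeb measure. The image of the internal set
[prod_n B_r(X n)], with the push-forward of the restricted Loeb measure, is a
compact pmm-subspace squeezed between [B_(r-e)] of [upmm] and [upmm]. Finite
nets and the internal sets they generate show that [B_r(X n)] is, for [U]-most
[n], as close to it as desired; a subsequence is extracted at the very end. No
choice of good radii is needed. *)

(** The obstacle is that taking balls does not commute with limits: the sphere of radius [r] in the
    limit may carry points and mass that come from just inside or just outside the balls of [X n].
    So the balls [ball_pmm (X n) r] approach [uball_pmm r], whose domain is only known to lie
    between the open and the closed [r]-ball of [upmm]. The infimum in [a_fun] tolerates exactly
    this defect. From [X n] to [upmm] the comparison subspace is [uball_pmm]; from [upmm] to [X n]
    it is a ball of slightly larger radius, found by continuity from above of the measure and by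
    compactness of closed balls. One ultraproduct serves all radii at once, so limits for different
    radii never have to be matched, and the Loeb construction yields the limit measure without a
    weak compactness argument. An arbitrary closed set enters the Prokhorov bound only through the
    net indices near it, so finitely many masses control all closed sets. *)

Local Notation dom X := (@Defs.dom _ X).
Local Notation msr X := (@Defs.msr _ X).

(** * Metrics and Borel measures on a subset *)

Lemma disjoint_setD (T : Type) (A B : set T) : [disjoint A & B `\` A].
Proof. by apply/eqP/seteqP; split => x // [Ax []]. Qed.

Section MetricOn.
Variables (R : realType) (T : Type) (D : set T) (d : T -> T -> R).
Hypothesis dM : is_metric_on D d.

Lemma metxx x : D x -> d x x = 0.
Proof. by move=> Dx; have [[_ ->]] := dM Dx Dx Dx. Qed.

Lemma met_eq0 x y : D x -> D y -> d x y = 0 -> x = y.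
Proof. by move=> Dx Dy; have [[+ _] _] := dM Dx Dy Dy; apply. Qed.

Lemma metC x y : D x -> D y -> d x y = d y x.
Proof. by move=> Dx Dy; have [_ []] := dM Dx Dy Dy. Qed.

Lemma met_triangle y x z : D x -> D y -> D z -> d x z <= d x y + d y z.
Proof. by move=> Dx Dy Dz; have [_ []] := dM Dx Dy Dz. Qed.

Lemma met_ge0 x y : D x -> D y -> 0 <= d x y.
Proof.
move=> Dx Dy; have := met_triangle Dx Dy Dx.
by rewrite metxx// (metC Dy Dx); lra.
Qed.

Lemma is_metric_on_sub (D' : set T) : D' `<=` D -> is_metric_on D' d.
Proof. by move=> sub x y z /sub Dx /sub Dy /sub Dz; exact: dM. Qed.

End MetricOn.

Section Borel.
Variables (R : realType) (T : Type) (D : set T) (d : T -> T -> R).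

Lemma borel_sub_sigma_algebra (G : set (set T)) :
  sigma_algebra D G -> open_in D d `<=` G -> borel_on D d `<=` G.
Proof. by move=> sG oG; apply: smallest_sub. Qed.

Lemma borel_subset A : borel_on D d A -> A `<=` D.
Proof.
move: A; apply: (@borel_sub_sigma_algebra [set A | A `<=` D]) => [|A []//].
split => [|A _ x []//|F FD x [n _]]; [exact: sub0set|exact: FD].
Qed.

Lemma borel_sigma_algebra : sigma_algebra D (borel_on D d).
Proof. exact: smallest_sigma_algebra. Qed.

Lemma borel0 : borel_on D d set0.
Proof. by have [] := borel_sigma_algebra. Qed.

Lemma borelC A : borel_on D d A -> borel_on D d (D `\` A).
Proof. by have [_ + _] := borel_sigma_algebra; apply. Qed.

Lemma borel_bigcup (F : (set T)^nat) :
  (forall n, borel_on D d (F n)) -> borel_on D d (\bigcup_n F n).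
Proof. by have [_ _] := borel_sigma_algebra; apply. Qed.

Lemma borel_open A : open_in D d A -> borel_on D d A.
Proof. exact: sub_smallest. Qed.

Lemma borel_closed A : A `<=` D -> open_in D d (D `\` A) -> borel_on D d A.
Proof.
move=> AD oA; have -> : A = D `\` (D `\` A) by rewrite setDD setIidr.
by apply: borelC; exact: borel_open.
Qed.

Lemma borelT : borel_on D d D.
Proof. by rewrite -[X in borel_on _ _ X]setD0; apply: borelC; exact: borel0. Qed.

Lemma borelU A B : borel_on D d A -> borel_on D d B -> borel_on D d (A `|` B).
Proof.
by move=> bA bB; rewrite -bigcup2E; apply: borel_bigcup => -[|[|n]] //=; exact: borel0.
Qed.

Lemma borelI A B : borel_on D d A -> borel_on D d B -> borel_on D d (A `&` B).
Proof.
move=> bA bB.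
have -> : A `&` B = D `\` ((D `\` A) `|` (D `\` B)).
  have AD := borel_subset bA; apply/seteqP; split => x /=.
    by move=> [Ax Bx]; split; [exact: AD|move=> [[]|[]]].
  by move=> [Dx nAB]; split; apply: contra_notP nAB => nx; [left|right].
by apply: borelC; apply: borelU; exact: borelC.
Qed.

Lemma borelD A B : borel_on D d A -> borel_on D d B -> borel_on D d (A `\` B).
Proof.
move=> bA bB; have -> : A `\` B = A `&` (D `\` B).
  have AD := borel_subset bA; apply/seteqP; split => x /=; last by case=> ? [].
  by move=> [Ax Bx]; split => //; split => //; exact: AD.
by apply: borelI => //; exact: borelC.
Qed.

Lemma borel_bigsetU n (F : nat -> set T) :
  (forall i, borel_on D d (F i)) -> borel_on D d (\big[setU/set0]_(i < n) F i).
Proof.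
move=> bF; elim/big_ind : _ => //; [exact: borel0|exact: borelU].
Qed.

Variable m : set T -> \bar R.
Hypothesis mM : is_borel_measure D d m.
Local Open Scope ereal_scope.

Lemma bmeasure0 : m set0 = 0. Proof. by case: mM. Qed.

Lemma bmeasure_ge0 A : borel_on D d A -> 0 <= m A.
Proof. by case: mM => _ [+ _]; exact. Qed.

Lemma bmeasureU A B : borel_on D d A -> borel_on D d B -> [disjoint A & B] ->
  m (A `|` B) = m A + m B.
Proof.
move=> bA bB AB; case: mM => m0 [_ mS].
have := mS (bigcup2 A B).
rewrite bigcup2E => /(_ _ _)/cvg_lim <- //.
- apply/cvg_lim => //; apply: cvg_near_cst; exists 2%N => //= n /= n2.
  rewrite (big_cat_nat _ n2)//= big_nat_recr//= big_nat1 /=.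
  by rewrite big_nat_cond big1 ?adde0// => -[|[|i]] //=.
- by case=> [|[|i]] //=; exact: borel0.
- by rewrite -trivIset_bigcup2; exact/eqP.
Qed.

Lemma le_bmeasure A B : borel_on D d A -> borel_on D d B -> A `<=` B ->
  m A <= m B.
Proof.
move=> bA bB AB; rewrite -(setDUK AB) bmeasureU//.
- by rewrite leeDl// bmeasure_ge0//; exact: borelD.
- exact: borelD.
- exact: disjoint_setD.
Qed.

Lemma bmeasureU_le A B : borel_on D d A -> borel_on D d B ->
  m (A `|` B) <= m A + m B.
Proof.
move=> bA bB; have -> : A `|` B = A `|` (B `\` A).
  apply/seteqP; split => x [Ax|]; [by left| |by left|by case; right].
  by have [Ax _|nAx Bx] := pselect (A x); [left|right].
rewrite bmeasureU//; first by rewrite leeD2l// le_bmeasure//; exact: borelD.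
- exact: borelD.
- exact: disjoint_setD.
Qed.

Lemma bmeasure_bigsetU_le n (F : nat -> set T) : (forall i, borel_on D d (F i)) ->
  m (\big[setU/set0]_(i < n) F i) <= \sum_(i < n) m (F i).
Proof.
move=> bF; elim: n => [|n ih]; first by rewrite !big_ord0 bmeasure0.
rewrite !big_ord_recr /=; apply: le_trans (bmeasureU_le (borel_bigsetU _ bF) (bF _)) _.
by rewrite leeD2r.
Qed.

End Borel.

(** * Subspaces and compactness *)

Section Subspace.
Variables (R : realType) (T : Type) (D E : set T) (d : T -> T -> R).
Hypotheses (ED : E `<=` D) (oE : open_in D d (D `\` E)).

(** As [E] is closed in [D], adjoining all of its complement turns a relatively open set into an
    open one with the same trace on [E]. Borel sets and open covers of [E] both lift to [D] this
    way. *)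
Lemma open_in_extend A : open_in E d A -> open_in D d (A `|` (D `\` E)).
Proof.
move=> [AE oA]; split; first by move=> x [/AE/ED|[]].
move=> x [/oA[e e0 eA]|Ex].
  exists e => // y Dy xy; have [Ey|nEy] := pselect (E y); last by right.
  by left; exact: eA.
have [e e0 eE] := oE.2 _ Ex.
by exists e => // y Dy xy; right; exact: eE.
Qed.

Lemma borel_on_closed_sub A : borel_on E d A -> borel_on D d A.
Proof.
have bE : borel_on D d E by exact: borel_closed.
move: A; apply: borel_sub_sigma_algebra => [|A oA].
  split; [exact: borel0|by move=> A bA; exact: borelD|exact: borel_bigcup].
have -> : A = (A `|` (D `\` E)) `&` E.
  rewrite setIUl setDKI setU0 setIidl//; exact: oA.1.
by apply: borelI => //; apply: borel_open; exact: open_in_extend.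
Qed.

Lemma is_borel_measure_restr (m : set T -> \bar R) : is_borel_measure D d m ->
  is_borel_measure E d (fun A => m (A `&` E)).
Proof.
move=> [m0 [m_ge0 mS]]; split; first by rewrite set0I.
have IE A : borel_on E d A -> A `&` E = A by move=> /borel_subset AE; exact: setIidl.
split=> [A bA|F bF tF]; first by rewrite IE//; apply: m_ge0; exact: borel_on_closed_sub.
under eq_fun do under eq_bigr do rewrite IE//.
rewrite IE; last exact: borel_bigcup.
by apply: mS => // n; exact: borel_on_closed_sub.
Qed.

Lemma compact_in_restr : compact_in D d E -> compact_in E d E.
Proof.
move=> [_ cE]; split=> // I U oU EU.
have [|x Ex|F finF EF] := cE I (fun i => U i `|` (D `\` E)).
- by move=> i; exact: open_in_extend.
- by have [i _ Ui] := EU x Ex; exists i => //; left.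
- exists F => // x Ex; have [i Fi [Ui|[]//]] := EF x Ex; by exists i.
Qed.

End Subspace.

Lemma open_in_ball_compl (R : realType) (T : Type) (D : set T) (d : T -> T -> R) x r :
  is_metric_on D d -> D x -> open_in D d (D `\` [set y | D y /\ d x y <= r]).
Proof.
move=> dM Dx; split=> [y []//|y [Dy] /not_andP[//|/negP]]; rewrite -ltNge => ry.
exists (d x y - r) => [|z Dz yz]; first by rewrite subr_gt0.
split=> // -[_ xz]; have := met_triangle dM Dx Dz Dy.
by rewrite (metC dM Dz Dy); lra.
Qed.

Lemma open_in_ball (R : realType) (T : Type) (D : set T) (d : T -> T -> R) x r :
  is_metric_on D d -> D x -> open_in D d [set y | D y /\ d x y < r].
Proof.
move=> dM Dx; split=> [y []//|y [Dy] xy].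
exists (r - d x y) => [|z Dz yz]; first by rewrite subr_gt0.
by split=> //; have := met_triangle dM Dx Dy Dz; lra.
Qed.

Section Balls.
Variables (R : realType) (X : pmm R).

Lemma borel_closed_ball x r : pmm_ok X -> dom X x ->
  borel_on (dom X) (@dst _ X) (closed_ball x r).
Proof.
move=> [dM _] Dx; apply: borel_closed; first by move=> y [].
exact: open_in_ball_compl.
Qed.

Lemma compact_ball_pmm r : bcompact_pmm X -> 0 <= r -> compact_pmm (ball_pmm X r).
Proof.
move=> [okX cX] r0; have [dM [Do mM]] := okX.
have bD : closed_ball (bpt X) r `<=` dom X by move=> y [].
have oE := open_in_ball_compl r dM Do.
split; [split; [|split]|split] => /=.
- exact: (is_metric_on_sub dM bD).
- by split=> //; rewrite (metxx dM).
- exact: (is_borel_measure_restr bD oE mM).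
- exact: (compact_in_restr bD oE (cX _ r Do).1).
- by rewrite setIid; have [] := cX _ r Do.
Qed.

End Balls.

Lemma compact_in_net (R : realType) (T : Type) (D K : set T) (d : T -> T -> R) o e :
  is_metric_on D d -> K o -> compact_in D d K -> 0 < e ->
  exists N (c : nat -> T), (forall i, K (c i)) /\
    forall x, K x -> exists2 i, (i < N)%N & d x (c i) < e.
Proof.
move=> dM Ko [KD cK] e0.
(* The conjunct [K x] empties the sets indexed by points outside [K], so every index that covers
   something is a center in [K]. *)
pose U (x : {classic T}) := [set y | K x /\ D y /\ d x y < e].
have [|x Kx|F /finite_seqP[s ->] Ks] := cK _ U.
- move=> x; split=> [y [_ []]//|y [Kx xy]].
  have [_ /(_ _ xy)[r r0 rP]] := open_in_ball e dM (KD _ Kx).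
  by exists r => // z Dz yz; split => //; exact: rP.
- by have Dx := KD _ Kx; exists x => //; split => //; split => //; rewrite (metxx dM).
exists (size s), (fun i => if `[< K (nth (o : {classic T}) s i) >]
  then nth (o : {classic T}) s i else o).
split=> [i|x /Ks[y /= ys [Ky [Dx yx]]]]; first by case: asboolP.
exists (index (y : {classic T}) s); first by rewrite index_mem.
rewrite nth_index//; case: asboolP => // _.
by rewrite (metC dM) //; exact: KD.
Qed.

Section CompleteTotallyBounded.
Variables (R : realType) (T : Type) (D K : set T) (d : T -> T -> R).
Hypotheses (dM : is_metric_on D d) (KD : K `<=` D).
Hypothesis net : forall e, 0 < e -> exists N (c : nat -> T),
  (forall i, D (c i)) /\ forall x, K x -> exists2 i, (i < N)%N & d x (c i) < e.
Hypothesis complete : forall x : nat -> T, (forall k, K (x k)) ->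
  (forall i j, (i <= j)%N -> d (x i) (x j) <= 2^-1 ^+ i) ->
  exists2 l, K l & forall i, d (x i) l <= 2 * 2^-1 ^+ i.

(** If [K] had no finite subcover, cutting it with ever finer nets would give nested pieces of
    diameter below [2^-j], none finitely covered. Points of these pieces converge to some [l], and a
    single [U i] around [l] swallows a whole piece. *)
Lemma complete_totally_bounded_compact : compact_in D d K.
Proof.
split=> // I U oU KU; apply: contrapT => nF.
pose fin A := exists2 F : set I, finite_set F & A `<=` \bigcup_(i in F) U i.
have step A e : A `<=` K -> 0 < e -> ~ fin A ->
    exists2 c, D c & ~ fin (A `&` [set x | d x c < e]).
  move=> AK e0 nA; have [N [c [Dc cP]]] := net e0.
  apply: contra_notP nA => noc.
  have /choice[F FP] i : exists F : set I, finite_set F /\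
      A `&` [set x | d x (c i) < e] `<=` \bigcup_(j in F) U j.
    have [[F fF AF]|nf] := pselect (fin (A `&` [set x | d x (c i) < e])).
      by exists F.
    by exfalso; apply: noc; exists (c i).
  exists (\bigcup_(i in `I_N) F i).
    by apply: bigcup_finite => // i _; have [] := FP i.
  move=> x Ax; have [i iN xi] := cP x (AK x Ax).
  by have [_ /(_ x (conj Ax xi))[j Fj Uj]] := FP i; exists j => //; exists i.
pose r j : R := 2^-1 ^+ j.
have r0 j : 0 < r j by rewrite exprn_gt0.
have /choice[nxt nxtP] (p : set T * nat) : exists c, p.1 `<=` K -> ~ fin p.1 ->
    D c /\ ~ fin (p.1 `&` [set x | d x c < r p.2 / 2]).
  have [pK|] := pselect (p.1 `<=` K /\ ~ fin p.1); last first.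
    (* The choice function must be total, so a piece that does not qualify gets an arbitrary point;
       one exists because an empty type would be finitely covered. *)
    move=> npK; have [x] : exists x : T, True.
      apply: contrapT => nx; apply: nF; exists set0; first exact: finite_set0.
      by move=> x; exfalso; apply: nx; exists x.
    by exists x => ? ?; exfalso; apply: npK.
  by have [c Dc cP] := step _ (r p.2 / 2) pK.1 (divr_gt0 (r0 _) (ltr0Sn _ 1)) pK.2; exists c.
have [A [A0 AS]] : exists A : nat -> set T, A 0%N = K /\
    forall j, A j.+1 = A j `&` [set x | d x (nxt (A j, j)) < r j / 2].
  by exists (fix A j := if j is j'.+1 then
    A j' `&` [set x | d x (nxt (A j', j')) < r j' / 2] else K).
have AP j : A j `<=` K /\ ~ fin (A j).
  elim: j => [|j [jK jf]]; [by rewrite A0; split|rewrite AS]; split; first by move=> x [/jK].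
  by have [] := nxtP (A j, j) jK jf.
have Ac j : D (nxt (A j, j)) by have [jK jf] := AP j; have [] := nxtP (A j, j) jK jf.
have Amono i j : (i <= j)%N -> A j `<=` A i.
  elim: j => [|j ih]; first by rewrite leqn0 => /eqP ->.
  by rewrite leq_eqVlt => /predU1P[-> //|/ih ji]; rewrite AS => x [/ji].
have Adist i x y : A i.+1 x -> A i.+1 y -> d x y < r i.
  rewrite AS => -[Ax /= xc] [Ay /= yc].
  have Dx : D x by apply: KD; apply: (AP i).1.
  have Dy : D y by apply: KD; apply: (AP i).1.
  have := met_triangle dM Dx (Ac i) Dy; rewrite (metC dM (Ac i) Dy); lra.
have /choice[x xP] j : exists x, A j.+1 x.
  apply: contrapT => nx; apply: (AP j.+1).2; exists set0 => [|x Ax]; first exact: finite_set0.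
  by exfalso; apply: nx; exists x.
have [k|i j ij|l Kl lP] := complete (x := x).
- exact: (AP k.+1).1.
- by apply/ltW/Adist => //; apply: (@Amono i.+1 j.+1).
have [i _ Ul] := KU l Kl; have [_ /(_ _ Ul)[e e0 eU]] := oU i.
(* A point of the piece is within [r j] of [x j], which is within [2 * r j] of [l]. *)
have [j jP] : exists j, 3 * r j < e.
  have h : `|2^-1 : R| < 1 by rewrite ger0_norm// invf_lt1// ltr1n.
  have /cvgr0Pnorm_lt/(_ _ e0)[j _ jP] := cvg_geometric 3 h.
  by exists j; apply: le_lt_trans (jP j (leqnn j)); rewrite ler_norm.
apply: (AP j.+1).2; exists [set i]; first exact: finite_set1.
move=> y Ay; exists i => //; apply: eU; first by apply: KD; apply: (AP j.+1).1.
have Dy : D y by apply: KD; apply: (AP j.+1).1.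
have Dx : D (x j) by apply: KD; apply: (AP j.+1).1.
have := met_triangle dM (KD Kl) Dx Dy; have := Adist _ _ _ (xP j) Ay.
by rewrite (metC dM (KD Kl) Dx); have := lP j; rewrite -/(r j); lra.
Qed.

End CompleteTotallyBounded.

(** * Gluing two metric spaces along a finite net *)

Section Glue.
Variables (R : realType) (T1 T2 : Type) (D1 : set T1) (D2 : set T2).
Variables (d1 : T1 -> T1 -> R) (d2 : T2 -> T2 -> R).
Hypotheses (d1M : is_metric_on D1 d1) (d2M : is_metric_on D2 d2).
Variables (N : nat) (c1 : 'I_N.+1 -> T1) (c2 : 'I_N.+1 -> T2) (delta : R).
Hypotheses (D1c : forall i, D1 (c1 i)) (D2c : forall i, D2 (c2 i)).
Hypotheses (delta0 : 0 < delta).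
Hypothesis dc : forall i j, `|d1 (c1 i) (c1 j) - d2 (c2 i) (c2 j)| <= 2 * delta.

(** On the disjoint union, the cross distance is the cheapest passage through a pair [c1 i], [c2 i],
    a crossing costing [delta]. A detour through the other space crosses twice and pays [2 * delta],
    which by [dc] makes up for what it can gain between two net points; [delta > 0] keeps the two
    copies disjoint. *)
Lemma metric_glue : exists (Z : mspace R) (f : T1 -> mcar Z) (g : T2 -> mcar Z),
  [/\ is_metric Z, forall x y, D1 x -> D1 y -> mdst (f x) (f y) = d1 x y,
      forall x y, D2 x -> D2 y -> mdst (g x) (g y) = d2 x y &
      forall i, mdst (f (c1 i)) (g (c2 i)) <= delta].
Proof.
pose e x y i := d1 x (c1 i) + delta + d2 (c2 i) y.
pose cr x y := e x y [arg min_(i < ord0) e x y i]%O.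
have cr_le x y i : cr x y <= e x y i by rewrite /cr; case: arg_minP => //= j _; apply.
have cr_ex x y : exists i, cr x y = e x y i by eexists.
pose Z := ({x | D1 x} + {y | D2 y})%type.
pose dZ (a b : Z) : R := match a, b with
  | inl x, inl y => d1 (sval x) (sval y)
  | inr x, inr y => d2 (sval x) (sval y)
  | inl x, inr y => cr (sval x) (sval y)
  | inr y, inl x => cr (sval x) (sval y) end.
have cr_gt0 x y : D1 x -> D2 y -> 0 < cr x y.
  move=> Dx Dy; have [i ->] := cr_ex x y; rewrite /e.
  have := met_ge0 d1M Dx (D1c i); have := met_ge0 d2M (D2c i) Dy.
  by move: delta0; lra.
have tri1 x x' y : D1 x -> D1 x' -> D2 y -> cr x y <= d1 x x' + cr x' y.
  move=> Dx Dx' Dy; have [i ->] := cr_ex x' y; apply: le_trans (cr_le x y i) _.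
  have := met_triangle d1M Dx Dx' (D1c i); rewrite /e; lra.
have tri2 x y y' : D1 x -> D2 y -> D2 y' -> cr x y <= cr x y' + d2 y' y.
  move=> Dx Dy Dy'; have [i ->] := cr_ex x y'; apply: le_trans (cr_le x y i) _.
  have := met_triangle d2M (D2c i) Dy' Dy; rewrite /e; lra.
have tri3 x x' y : D1 x -> D1 x' -> D2 y -> d1 x x' <= cr x y + cr x' y.
  move=> Dx Dx' Dy; have [i ->] := cr_ex x y; have [j ->] := cr_ex x' y; rewrite /e.
  have := dc i j; rewrite ler_norml => /andP[_].
  have := met_triangle d1M Dx (D1c i) Dx'.
  have := met_triangle d1M (D1c i) (D1c j) Dx'.
  have := met_triangle d2M (D2c i) Dy (D2c j).
  rewrite (metC d1M Dx' (D1c j)) (metC d2M Dy (D2c j)); lra.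
have tri4 x y y' : D1 x -> D2 y -> D2 y' -> d2 y y' <= cr x y + cr x y'.
  move=> Dx Dy Dy'; have [i ->] := cr_ex x y; have [j ->] := cr_ex x y'; rewrite /e.
  have := dc i j; rewrite ler_norml => /andP[+ _].
  have := met_triangle d2M Dy (D2c i) Dy'.
  have := met_triangle d2M (D2c i) (D2c j) Dy'.
  have := met_triangle d1M (D1c i) Dx (D1c j).
  rewrite (metC d1M Dx (D1c i)) (metC d2M Dy (D2c i)); lra.
(* The metric of [Z] must hold on its whole carrier, hence the subset types; points outside the
   domain go to the first net point. *)
pose f x : Z := if pselect (D1 x) is left Dx then inl (exist _ x Dx)
                else inl (exist _ (c1 ord0) (D1c ord0)).
pose g y : Z := if pselect (D2 y) is left Dy then inr (exist _ y Dy)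
                else inr (exist _ (c2 ord0) (D2c ord0)).
have fE x (Dx : D1 x) : f x = inl (exist _ x Dx).
  by rewrite /f; case: pselect => // Dx'; congr (inl (exist _ x _)); exact: Prop_irrelevance.
have gE y (Dy : D2 y) : g y = inr (exist _ y Dy).
  by rewrite /g; case: pselect => // Dy'; congr (inr (exist _ y _)); exact: Prop_irrelevance.
exists (MSpace dZ), f, g; split => /=.
- have sym a b : dZ a b = dZ b a.
    case: a b => [[x Dx]|[x Dx]] [[y Dy]|[y Dy]] //=; [exact: (metC d1M)|exact: (metC d2M)].
  move=> a b c _ _ _ /=; split; last split => //.
    case: a b {c} => [[x Dx]|[x Dx]] [[y Dy]|[y Dy]] /=; split.
    - move=> /(met_eq0 d1M Dx Dy) xy; subst y.
      by congr (inl (exist _ x _)); exact: Prop_irrelevance.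
    - move=> /(congr1 (fun a : Z => if a is inl z then d1 x (sval z) else 0)) /= <-.
      exact: (metxx d1M).
    - by move=> h; have := cr_gt0 _ _ Dx Dy; rewrite h ltxx.
    - by [].
    - by move=> h; have := cr_gt0 _ _ Dy Dx; rewrite h ltxx.
    - by [].
    - move=> /(met_eq0 d2M Dx Dy) xy; subst y.
      by congr (inr (exist _ x _)); exact: Prop_irrelevance.
    - move=> /(congr1 (fun a : Z => if a is inr z then d2 x (sval z) else 0)) /= <-.
      exact: (metxx d2M).
  case: a b c => [[x Dx]|[x Dx]] [[y Dy]|[y Dy]] [[z Dz]|[z Dz]] /=.
  - exact: (met_triangle d1M).
  - exact: tri1.
  - exact: tri3.
  - exact: tri2.
  - by rewrite addrC (metC d1M Dy Dz); exact: tri1.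
  - exact: tri4.
  - by rewrite addrC (metC d2M Dx Dy); exact: tri2.
  - exact: (met_triangle d2M).
- by move=> x y Dx Dy; rewrite !fE.
- by move=> x y Dx Dy; rewrite !gE.
- move=> i; rewrite (fE _ (D1c i)) (gE _ (D2c i)) /=.
  by apply: le_trans (cr_le _ _ i) _; rewrite /e (metxx d1M)// (metxx d2M)// add0r addr0.
Qed.

End Glue.

(** * Isometric embeddings into a common space and the distance [dGHPc] *)

Section Embeddings.
Variables (R : realType) (Z : mspace R).
Hypothesis ZM : is_metric Z.

Lemma zdistC (x y : mcar Z) : mdst x y = mdst y x.
Proof. by apply: (metC ZM). Qed.

Lemma zdist_triangle (y x z : mcar Z) : mdst x z <= mdst x y + mdst y z.
Proof. by apply: (met_triangle ZM). Qed.

Lemma zdist_ge0 (x y : mcar Z) : 0 <= mdst x y.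
Proof. by apply: (met_ge0 ZM). Qed.

Variables (T : Type) (D : set T) (d : T -> T -> R) (f : T -> mcar Z).
Hypothesis fD : forall x y, D x -> D y -> mdst (f x) (f y) = d x y.

Lemma open_in_preimage_nbhd (A : set (mcar Z)) e :
  open_in D d (D `&` f @^-1` nbhd_eps A e).
Proof.
split=> [x []//|x [Dx [a Aa xa]]].
exists (e - mdst (f x) a) => [|y Dy xy]; first by rewrite subr_gt0.
split=> //; exists a => //; have := zdist_triangle (f x) (f y) a.
by rewrite (zdistC (f y) (f x)) fD//; lra.
Qed.

Lemma open_in_preimage_closed (A : set (mcar Z)) :
  mclosed A -> open_in D d (D `\` (D `&` f @^-1` A)).
Proof.
move=> cA; split=> [x []//|x [Dx nAx]].
have [e e0 eP] : exists2 e, 0 < e & forall a, A a -> e <= mdst (f x) a.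
  apply: contrapT => ne; apply: nAx; split=> //; apply: cA => e e0.
  apply: contrapT => na; apply: ne; exists e => // a Aa.
  by rewrite leNgt; apply/negP => xa; apply: na; exists a.
exists e => // y Dy xy; split=> // -[_ Ay].
by have := eP _ Ay; rewrite fD//; lra.
Qed.

Lemma borel_preimage_nbhd (A : set (mcar Z)) e :
  borel_on D d (D `&` f @^-1` nbhd_eps A e).
Proof. by apply: borel_open; exact: open_in_preimage_nbhd. Qed.

Lemma borel_preimage_closed (A : set (mcar Z)) : mclosed A ->
  borel_on D d (D `&` f @^-1` A).
Proof.
by move=> cA; apply: borel_closed; [move=> x []|exact: open_in_preimage_closed].
Qed.

End Embeddings.

Section DGHPc.
Variables (R : realType) (X Y : pmm R).
Local Open Scope ereal_scope.

Lemma dGHPc_le (Z : mspace R) (f : car X -> mcar Z) (g : car Y -> mcar Z) (e : R) :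
  is_metric Z -> isom_emb f -> isom_emb g -> (0 < e)%R ->
  (mdst (f (bpt X)) (g (bpt Y)) <= e)%R ->
  (forall x, dom X x -> exists2 y, dom Y y & (mdst (f x) (g y) < e)%R) ->
  (forall y, dom Y y -> exists2 x, dom X x & (mdst (f x) (g y) < e)%R) ->
  (forall A, mclosed A -> pushf f A <= pushf g (nbhd_eps A e) + e%:E /\
                          pushf g A <= pushf f (nbhd_eps A e) + e%:E) ->
  dGHPc X Y <= e%:E.
Proof.
move=> ZM fI gI e0 oo XY YX mXY; apply: le_trans.
  by apply: ereal_inf_lbound; exists Z, f, g; split.
rewrite !ge_max lee_fin oo /=; apply/andP; split; apply: ereal_inf_lbound.
  exists e => //; split=> //; split=> _ [z Dz <-].
    by have [y Dy zy] := XY z Dz; exists (g y) => //; exists y.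
  by have [x Dx zx] := YX z Dz; exists (f x); [exists x|rewrite zdistC].
by exists e.
Qed.

(** These are the estimates that carry nets and mass bounds from [Y] to [X]. The Prokhorov constant
    [h] stays separate from [e] because masses are not known to be monotone on sets of the form
    [nbhd_eps A e] until these are known to be Borel. *)
Lemma dGHPc_lt (e : R) : dGHPc X Y < e%:E ->
  exists (Z : mspace R) (f : car X -> mcar Z) (g : car Y -> mcar Z) (h : R),
  [/\ is_metric Z, isom_emb f, isom_emb g & [/\ (h < e)%R,
    (mdst (f (bpt X)) (g (bpt Y)) < e)%R,
    (forall x, dom X x -> exists2 y, dom Y y & (mdst (f x) (g y) < e)%R) &
    (forall A, mclosed A -> pushf f A <= pushf g (nbhd_eps A h) + h%:E)]].
Proof.
move=> /ereal_inf_lt[_ [Z [f [g [ZM fI gI ->]]]]].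
rewrite !gt_max lte_fin => /and3P[oo].
move=> /ereal_inf_lt[_ [e1 [_ [XY _]] <-]]; rewrite lte_fin => e1e.
move=> /ereal_inf_lt[_ [h [_ hP] <-]]; rewrite lte_fin => he.
exists Z, f, g, h; split=> //; split=> // [x Dx|A /hP[]//].
have [|_ [y Dy <-] xy] := XY (f x); first by exists x.
by exists y => //; exact: lt_trans e1e.
Qed.

Lemma dGHPc_ge0 : 0 <= dGHPc X Y.
Proof.
apply: le_ereal_inf_tmp => _ [Z [f [g [ZM _ _ ->]]]].
by rewrite le_max lee_fin zdist_ge0.
Qed.

Lemma dGHP_ge0 : 0 <= dGHP X Y.
Proof.
rewrite le_min lee01 /=; apply: le_ereal_inf_tmp => _ [e [/andP[e0 _] _] <-].
by rewrite lee_fin ltW.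
Qed.

End DGHPc.

(** * Transfer of nets and masses *)

Lemma finite_set_nat_bound (F : set nat) : finite_set F ->
  exists N, forall n, F n -> (n <= N)%N.
Proof.
move=> /finite_seqP[s ->]; exists (\max_(i <- s) i)%N => n /= ns.
exact: leq_bigmax_seq.
Qed.

(** For [x] outside [E], the sets of points of [E] farther than [1/(n+1)] from [x] cover [E]; a
    finite subcover bounds the distance from [x] to [E] below. *)
Lemma compact_in_closed (R : realType) (T : Type) (D E : set T) (d : T -> T -> R) :
  is_metric_on D d -> E `<=` D -> compact_in E d E -> open_in D d (D `\` E).
Proof.
move=> dM ED [_ cE]; split=> [x []//|x [Dx nEx]].
have [|y Ey|F /finite_set_nat_bound[N FN] EF] :=
    cE nat (fun n => [set y | E y /\ n.+1%:R^-1 < d x y]).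
- move=> n; move: (n.+1%:R^-1) => q; split=> [y []//|y [Ey /= ny]].
  exists (d x y - q) => [|z Ez yz]; first by rewrite subr_gt0.
  split=> //=; have := met_triangle dM Dx (ED _ Ez) (ED _ Ey).
  by rewrite (metC dM (ED _ Ez) (ED _ Ey)); lra.
- have : 0 < d x y.
    rewrite lt_neqAle (met_ge0 dM) ?andbT//; last exact: ED.
    by apply/eqP => /esym/(met_eq0 dM Dx (ED _ Ey)) xy; subst y.
  by move=> /ltr_add_invr[n]; rewrite add0r => ny; exists n.
exists N.+1%:R^-1; first by rewrite invr_gt0.
move=> y Dy xy; split=> // Ey; have [n Fn [_ /=]] := EF y Ey.
apply/negP; rewrite -leNgt; apply: (le_trans (ltW xy)).
by rewrite lef_pV2 ?posrE// ler_nat ltnS FN.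
Qed.

Section Transfer.
Variables (R : realType) (X Y : pmm R).

Definition has_net (Z : pmm R) (r e : R) (N : nat) := exists c : nat -> car Z,
  (forall i, closed_ball (bpt Z) r (c i)) /\
  forall x, closed_ball (bpt Z) r x -> exists2 i, (i < N)%N & dst x (c i) < e.

(** A point of [B_r(X)] is within [e] of some point of [D], and the base points are within [e] of
    each other, so that point lies within [r + 2 * e <= r + 1] of the base point of [Y]. The same
    estimate confines the [k]-neighbourhood of the image of [B_r(X)], which gives the mass bound. *)
Lemma net_mass_transfer (r s e h : R) (N : nat)
    (D : set (car Y)) (m : set (car Y) -> \bar R) :
  pmm_ok X -> pmm_ok Y -> 0 <= r -> r <= s -> e <= 2^-1 ->
  compact_pmm (sub_pmm D m) -> pmm_le D m (dom Y) (msr Y) ->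
  (dGHPc (ball_pmm X s) (sub_pmm D m) < e%:E)%E ->
  has_net Y (r + 1) h N ->
  has_net X r (2 * (e + h)) N /\
  (msr X (closed_ball (bpt X) r) <= msr Y (closed_ball (bpt Y) (r + 1)) + 1)%E.
Proof.
move=> [XM [Xo _]] [YM [Yo mY]] r0 rs e2 [[DM [Do mD]] [cD _]] [DY mle].
move=> /dGHPc_lt[Z [f [g [k [ZM fI gI [ke oo XD mXD]]]]]] [c [cY cP]].
have [/= fI' gI'] := (fI, gI).
have rsub x : closed_ball (bpt X) r x -> closed_ball (bpt X) s x.
  by move=> [Dx xr]; split=> //; exact: le_trans rs.
have obr : closed_ball (bpt X) r (bpt X) by split=> //; rewrite (metxx XM).
have far a y : D y -> (mdst (f (bpt X)) a <= r) -> mdst (g y) a < e ->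
    closed_ball (bpt Y) (r + 1) y.
  move=> Dy ra ya; split; first exact: DY.
  rewrite -gI//; have := zdist_triangle ZM (f (bpt X)) (g (bpt Y)) (g y).
  have := zdist_triangle ZM a (f (bpt X)) (g y).
  move: oo; rewrite (zdistC ZM (f (bpt X)) (g (bpt Y))) (zdistC ZM a (g y)) /=; lra.
split.
  pose near x i := exists y, [/\ D y, dst y (c i) < h & mdst (f x) (g y) < e].
  (* Each net point of [Y] is pulled back to a point of [B_r(X)] near it, if there is one, and to
     the base point otherwise. Two points of [B_r(X)] near the same [c i] differ by less than
     [e + h + h + e]. *)
  have /choice[c' c'P] i : exists x, closed_ball (bpt X) r x /\
      ((exists2 x, closed_ball (bpt X) r x & near x i) -> near x i).
    have [[x xr xi]|nx] := pselect (exists2 x, closed_ball (bpt X) r x & near x i).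
      by exists x.
    by exists (bpt X).
  exists c'; split=> [i|x xr]; first by have [] := c'P i.
  have [y Dy xy] := XD x (rsub _ xr).
  have [|i iN yi] := cP y.
    apply: (far (f x)) => //; last by rewrite zdistC.
    by rewrite fI; [case: xr|exact: rsub|exact: rsub].
  have ni : near x i by exists y.
  have [ci /(_ (ex_intro2 _ _ x xr ni))[y' [Dy' y'i xy']]] := c'P i.
  exists i => //; rewrite -fI; [|exact: rsub|exact: rsub].
  have := zdist_triangle ZM (g y) (f x) (f (c' i)).
  have := zdist_triangle ZM (g y') (g y) (f (c' i)).
  rewrite gI// (zdistC ZM (g y') (f (c' i))).
  have := met_triangle YM (DY _ Dy) (cY i).1 (DY _ Dy').
  by rewrite (metC YM (cY i).1 (DY _ Dy')) /=; lra.
(* The Prokhorov bound is tested on a closed ball of [Z], whose trace on the image of the [s]-ball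
   is that of [B_r(X)]. *)
pose A := [set z | mdst (f (bpt X)) z <= r].
have cA : mclosed A.
  move=> z zP; rewrite /A /= leNgt; apply/negP => rz.
  have [a Aa za] := zP (mdst (f (bpt X)) z - r) ltac:(by rewrite subr_gt0).
  have := zdist_triangle ZM a (f (bpt X)) z; move: Aa; rewrite (zdistC ZM a z) /A /=; lra.
have eA : closed_ball (bpt X) r =
    closed_ball (bpt X) s `&` f @^-1` A `&` closed_ball (bpt X) s.
  apply/seteqP; split=> x /=.
    move=> xr; have xs := rsub _ xr; split=> //; split=> //.
    by rewrite /A /= fI//; [case: xr|exact: rsub].
  by move=> [[xs]]; rewrite /A /= fI//; [move=> ? _; split=> //; case: xs|exact: rsub].
have bB : borel_on D (@dst _ Y) (D `&` closed_ball (bpt Y) (r + 1)).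
  have -> : D `&` closed_ball (bpt Y) (r + 1) = [set y | D y /\ dst (bpt Y) y <= r + 1].
    by apply/seteqP; split=> y /= [Dy]; [case=> _|split=> //; split=> //; exact: DY].
  by apply: borel_closed; [move=> y []|exact: open_in_ball_compl].
have oD := compact_in_closed YM DY cD.
rewrite eA; apply: le_trans (mXD A cA) _.
apply: leeD; last by rewrite lee_fin; lra.
apply: (@le_trans _ _ (m (D `&` closed_ball (bpt Y) (r + 1)))).
  apply: (le_bmeasure mD) => //; first exact: (borel_preimage_nbhd ZM gI).
  move=> y [Dy [a Aa ya]]; split=> //; apply: far Dy Aa _; exact: lt_trans ke.
apply: le_trans (mle _ bB) _; apply: (le_bmeasure mY).
- exact: borel_on_closed_sub DY oD _ bB.
- exact: borel_closed_ball.
- by move=> y [].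
Qed.

End Transfer.

(** Otherwise choose [v N] in [C] violating [Q] at [N]. A bound [M] valid at [v (phi k)] with
    [k >= M] contradicts this choice, since [phi k >= k >= M] and [Q] is monotone. *)
Lemma uniform_of_subsequence (T : Type) (C : set T) (Q : T -> nat -> Prop) :
  (forall x N M, (N <= M)%N -> Q x N -> Q x M) ->
  (forall v : nat -> T, (forall n, C (v n)) -> exists (phi : nat -> nat) M,
     {homo phi : m n / (m < n)%N >-> (m < n)%N} /\
     (forall K, exists2 k, (K <= k)%N & Q (v (phi k)) M)) ->
  exists N, forall x, C x -> Q x N.
Proof.
move=> Qmono sub; apply: contrapT => nN.
have /choice[v vP] N : exists x, C x /\ ~ Q x N.
  apply: contrapT => nx; apply: nN; exists N => x Cx; apply: contrapT => nQ.
  by apply: nx; exists x.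
have [n|phi [M [phi_lt /(_ M)[k Mk Qk]]]] := sub v; first by have [] := vP n.
have phi_ge n : (n <= phi n)%N.
  by elim: n => [//|n ih]; apply: leq_ltn_trans ih _; exact: phi_lt.
by have [_ []] := vP (phi k); apply: Qmono Qk; exact: leq_trans (phi_ge k).
Qed.

Section Subsequences.
Variables (R : realType).
Local Open Scope ereal_scope.

Lemma cvge0_frequently (a : nat -> \bar R) (e : R) K : (0 < e)%R ->
  a @ \oo --> 0 -> exists2 k, (K <= k)%N & a k < e%:E.
Proof.
move=> e0 /fine_cvgP[[N1 _ N1P] /cvgr0Pnorm_lt/(_ _ e0)[N2 _ N2P]].
exists (maxn K (maxn N1 N2)); first exact: leq_maxl.
have h1 : (N1 <= maxn K (maxn N1 N2))%N by rewrite 2!leq_max leqnn orbT.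
have h2 : (N2 <= maxn K (maxn N1 N2))%N by rewrite 2!leq_max leqnn !orbT.
rewrite -(fineK (N1P _ h1)) lte_fin; apply: le_lt_trans (N2P _ h2).
exact: ler_norm.
Qed.

(** A set of [U] meets every cofinite set, so indices with [a n <= 1/(k+1)] exist beyond any given
    one. *)
Lemma cvge0_subsequence (U : set_system nat) (a : nat -> \bar R) :
  ProperFilter U -> (\oo : set_system nat) `<=` U -> (forall n, 0 <= a n) ->
  (forall e : R, (0 < e)%R -> U [set n | a n <= e%:E]) ->
  exists phi : nat -> nat, {homo phi : m n / (m < n)%N >-> (m < n)%N} /\
    (a \o phi) @ \oo --> 0.
Proof.
move=> PU ooU a0 aU.
have /choice[nxt nxtP] (p : nat * nat) : exists n, (p.1 < n)%N /\ a n <= (p.2.+1%:R^-1)%:E.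
  have h1 := aU (p.2.+1%:R^-1)%R ltac:(by rewrite invr_gt0).
  have h2 : U [set n | (p.1 < n)%N] by apply: ooU; exists p.1.+1.
  by have [n [nP pn]] := filter_ex (filterI h1 h2); exists n.
pose phi := fix phi k := if k is k'.+1 then nxt (phi k', k) else nxt (0%N, 0%N).
have phiE k : a (phi k) <= (k.+1%:R^-1)%:E.
  by case: k => [|k]; [have [_] := nxtP (0%N, 0%N)|have [_] := nxtP (phi k, k.+1)].
exists phi; split.
  apply: homo_ltn => [|k]; first exact: ltn_trans.
  by have [] := nxtP (phi k, k.+1).
apply: (@squeeze_cvge _ _ _ _ (cst 0) _ (fun k => (k.+1%:R^-1)%:E)).
- by apply: nearW => k /=; rewrite a0 phiE.
- exact: cvg_cst.
- apply: cvg_EFin; first exact: nearW.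
  exact: cvg_harmonic.
Qed.

End Subsequences.

(** * Caratheodory measures *)

Section CaratheodoryMeasure.
Variables (R : realType) (T : Type) (mu : {outer_measure set T -> \bar R}).
Local Open Scope ereal_scope.

(** Subadditivity gives one inequality; the other is the countable splitting inequality for disjoint
    Caratheodory sets, tested on their own union. *)
Lemma caratheodory_sigma_additive (F : (set T)^nat) :
  (forall n, mu.-caratheodory (F n)) -> trivIset setT F ->
  (fun n => \sum_(0 <= i < n) mu (F i)) @ \oo --> mu (\bigcup_n F n).
Proof.
move=> mF tF; suff -> : mu (\bigcup_n F n) = \sum_(0 <= i <oo) mu (F i).
  by apply: is_cvg_nneseries => n _ _; exact: outer_measure_ge0.
apply/eqP; rewrite eq_le outer_measure_sigma_subadditive /=.
have := caratheodory_lime_le mF tF (\bigcup_n F n).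
rewrite setICr outer_measure0 adde0; apply: le_trans.
rewrite le_eqVlt; apply/orP; left; apply/eqP; apply: eq_eseriesr => n _.
by congr (mu _); rewrite setIidr//; exact: bigcup_sup.
Qed.

Lemma caratheodory_continuity (t0 : T) (F : (set T)^nat) (e : R) : (0 < e)%R ->
  (forall n, mu.-caratheodory (F n)) -> (forall n m, (n <= m)%N -> F m `<=` F n) ->
  mu (F 0%N) < +oo ->
  exists k, forall j, (k <= j)%N -> mu (F j `\` \bigcap_n F n) <= e%:E.
Proof.
move=> e0 mF Fmono F0.
(* The point [t0] gives [T] the structure over which the Caratheodory sets form a measurable type,
   so that continuity from above applies to [mu]. *)
pose T' : pointedType := HB.pack T (Choice.on {classic T}) (isPointed.Build T t0).
pose mu' : {outer_measure set T' -> \bar R} := mu.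
pose G j := F j `\` \bigcap_n F n.
have mI : mu.-caratheodory (\bigcap_n F n).
  rewrite -[X in _ X]setCK setC_bigcap; apply: caratheodory_measurable_setC.
  apply: caratheodory_measurable_bigcup => n; exact: caratheodory_measurable_setC.
have mG j : mu.-caratheodory (G j) by exact: caratheodory_measurable_setD.
have G0 : \bigcap_n G n = set0.
  by apply/seteqP; split=> // x Gx; have [_ []] := Gx 0%N I; move=> n _; have [] := Gx n I.
have Gcvg : (mu \o G) @ \oo --> 0.
  rewrite -[X in _ --> X](outer_measure0 mu) -G0.
  apply: (@nonincreasing_cvg_mu _ (caratheodory_type mu') R mu' G) => //.
  - by apply: le_lt_trans F0; apply: le_outer_measure => x [].
  - by rewrite G0; exact: caratheodory_measurable_set0.
  - move=> n m nm; apply/subsetPset => x [Fx nFx]; split=> //; exact: Fmono Fx.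
have [k _ kP] := cvge0_frequently 0 e0 Gcvg.
exists k => j kj; apply: le_trans (ltW kP); apply: le_outer_measure.
by move=> x [Fx nFx]; split=> //; exact: Fmono Fx.
Qed.
End CaratheodoryMeasure.

(** * Limits along an ultrafilter and the Loeb measure *)

Lemma dependent_choice_fun (I : Type) (T : I -> Type) (P : forall i, T i -> Prop) :
  (forall i, exists x, P i x) -> exists f : forall i, T i, forall i, P i (f i).
Proof. by move=> h; exists (fun i => projT1 (cid (h i))) => i; exact: projT2 (cid (h i)). Qed.

Section UltraLimits.
Variables (R : realType) (U : set_system nat).
Context {UU : UltraFilter U}.

Lemma ultraN (P : set nat) : ~ U P -> U (~` P).
Proof. by move=> nP; have [] := in_ultra_setVsetC P UU. Qed.

Definition ucvg (f : nat -> R) (l : R) := forall e, 0 < e -> U [set n | `|f n - l| < e].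

(** For a bounded sequence this is the limit along [U]: were [f n < ulim f + e] to fail to hold for
    [U]-most [n], the ultrafilter property would put [ulim f + e] into the set. *)
Definition ulim (f : nat -> R) : R := sup [set c | U [set n | c <= f n]].

Lemma ulimP (f : nat -> R) M : U [set n | `|f n| <= M] -> ucvg f (ulim f).
Proof.
move=> fM e e0; set A := [set c | U [set n | c <= f n]].
have supA : has_sup A.
  split; first by exists (- M); apply: filterS fM => n /=; rewrite ler_norml => /andP[].
  exists M => c Ac; have [n [/= cn]] := filter_ex (filterI Ac fM).
  by rewrite ler_norml => /andP[_]; exact: le_trans.
have [c Ac cl] := sup_adherent e0 supA.
have h : U [set n | f n < ulim f + e].
  have [//|/ultraN nA] := pselect (U [set n | f n < ulim f + e]).
  have : A (ulim f + e) by apply: filterS nA => n /= /negP; rewrite -leNgt.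
  by move=> /(ub_le_sup supA.2); rewrite -/(ulim f); lra.
apply: filterS (filterI Ac h) => n /= [cn nl].
by rewrite ltr_norml -/(ulim f) in cl *; apply/andP; split; lra.
Qed.

Lemma ucvg_le f g a b : ucvg f a -> ucvg g b -> U [set n | f n <= g n] -> a <= b.
Proof.
move=> fa gb fg; apply/ler_addgt0Pr => e e0.
have e2 : 0 < e / 2 by rewrite divr_gt0.
have [n [[/= h1 h2] h3]] := filter_ex (filterI (filterI (fa _ e2) (gb _ e2)) fg).
by move: h1 h2 h3; rewrite !ltr_norml; lra.
Qed.

Lemma ucvgD f g a b : ucvg f a -> ucvg g b -> ucvg (fun n => f n + g n) (a + b).
Proof.
move=> fa gb e e0; have e2 : 0 < e / 2 by rewrite divr_gt0.
apply: filterS (filterI (fa _ e2) (gb _ e2)) => n /= [].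
by rewrite !ltr_norml => /andP[? ?] /andP[? ?]; apply/andP; split; lra.
Qed.

Lemma ucvg_cst a : ucvg (fun=> a) a.
Proof. by move=> e e0; apply: filterS filterT => n _ /=; rewrite subrr normr0. Qed.

Lemma ucvg_eq f g a b : ucvg f a -> ucvg g b -> U [set n | f n = g n] -> a = b.
Proof.
move=> fa gb fg; apply/eqP; rewrite eq_le (ucvg_le fa gb) ?(ucvg_le gb fa)//;
by apply: filterS fg => n /= ->.
Qed.

Lemma filter_all_lt N (P : nat -> set nat) :
  (forall i, U (P i)) -> U [set n | forall i, (i < N)%N -> P i n].
Proof.
move=> UP; elim: N => [|N ih]; first by apply: filterS filterT.
apply: filterS (filterI ih (UP N)) => n /= [h Pn] i.
by rewrite ltnS leq_eqVlt => /predU1P[->//|]; exact: h.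
Qed.

Local Open Scope ereal_scope.

(* The limit along [U], which exists in the extended reals for every sequence. *)
Definition ulimE (f : nat -> \bar R) : \bar R :=
  ereal_inf [set c | U [set n | f n <= c]].

Lemma ulimE_lt f c : ulimE f < c -> U [set n | f n < c].
Proof.
move=> /ereal_inf_lt[b fb bc]; apply: filterS fb => n /= fn.
exact: le_lt_trans bc.
Qed.

Lemma ulimE_le f c : U [set n | f n <= c] -> ulimE f <= c.
Proof. by move=> fc; exact: ereal_inf_lbound. Qed.

Lemma ulimE_gt f c : c < ulimE f -> U [set n | c < f n].
Proof.
move=> cf; have [//|/ultraN nc] := pselect (U [set n | c < f n]).
have : ulimE f <= c by apply: ulimE_le; apply: filterS nc => n /= /negP; rewrite -leNgt.
by rewrite leNgt cf.
Qed.

Lemma ulimE_ge f c : U [set n | c <= f n] -> c <= ulimE f.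
Proof.
move=> cf; apply: le_ereal_inf_tmp => b fb.
by have [n [/= /le_trans h /h]] := filter_ex (filterI cf fb).
Qed.

Lemma le_ulimE f g : U [set n | f n <= g n] -> ulimE f <= ulimE g.
Proof.
move=> fg; apply: le_ereal_inf_tmp => b gb; apply: ulimE_le.
by apply: filterS (filterI fg gb) => n /= [/le_trans]; apply.
Qed.

(** Any real upper bound of the sums also bounds both summands, so both limits are finite and can be
    approximated from below at a common index. This is the direction required by Caratheodory
    splitting. *)
Lemma ulimE_superadditive f g : (forall n, 0 <= f n) -> (forall n, 0 <= g n) ->
  ulimE f + ulimE g <= ulimE (fun n => f n + g n).
Proof.
move=> f0 g0; apply: le_ereal_inf_tmp => -[c| |] fgc; last 2 first.
- by rewrite leey.
- by have [n /=] := filter_ex fgc; rewrite leNgt (lt_le_trans _ (adde_ge0 (f0 n) (g0 n))).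
have finf (h : nat -> \bar R) : (forall n, 0 <= h n) ->
    (forall n, h n <= f n + g n) -> ulimE h \is a fin_num.
  move=> h0 hfg; rewrite ge0_fin_numE; last first.
    by apply: ulimE_ge; apply: filterS filterT => n _ /=.
  apply: le_lt_trans (ltry c); apply: ulimE_le; apply: filterS fgc => n /=.
  exact: le_trans.
have /fineK ff : ulimE f \is a fin_num by apply: finf => // n; rewrite leeDl.
have /fineK gg : ulimE g \is a fin_num by apply: finf => // n; rewrite leeDr.
apply/lee_addgt0Pr => e e0; rewrite -ff -gg; set a := fine _; set b := fine _.
have fa : U [set n | (a - e / 2)%:E < f n].
  by apply: ulimE_gt; rewrite -ff lte_fin -/a; lra.
have gb : U [set n | (b - e / 2)%:E < g n].
  by apply: ulimE_gt; rewrite -gg lte_fin -/b; lra.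
have [n [[/= h1 h2] h3]] := filter_ex (filterI (filterI fa gb) fgc).
have := le_trans (ltW (lteD h1 h2)) h3.
by rewrite -EFinD -!EFinD !lee_fin; lra.
Qed.

End UltraLimits.

Section Loeb.
Variables (R : realType) (X : nat -> pmm R) (U : set_system nat).
Context {UU : UltraFilter U}.
Hypothesis ooU : (\oo : set_system nat) `<=` U.
Hypothesis okX : forall n, pmm_ok (X n).

Local Notation S := (forall n, car (X n)).
Local Notation borelX n := (borel_on (dom (X n)) (@dst R (X n))).

Definition internal (C : forall n, set (car (X n))) : set S :=
  [set x | U [set n | C n (x n)]].

Local Open Scope ereal_scope.

(** Covers by a single internal set, instead of countable families, already give an outer measure,
    and they make the mass of an internal set directly computable. *)
Definition loeb (A : set S) : \bar R :=
  ereal_inf [set ulimE U (fun n => msr (X n) (C n)) | C in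
    [set C | (forall n, borelX n (C n)) /\ A `<=` internal C]].

Lemma loeb_le A C : (forall n, borelX n (C n)) -> A `<=` internal C ->
  loeb A <= ulimE U (fun n => msr (X n) (C n)).
Proof. by move=> bC AC; apply: ereal_inf_lbound; exists C. Qed.

Let msr_ge0 n A : borelX n A -> 0 <= msr (X n) A.
Proof. by have [_ [_ mM]] := okX n; exact: bmeasure_ge0. Qed.

Lemma loeb_ge0 A : 0 <= loeb A.
Proof.
apply: le_ereal_inf_tmp => _ [C [bC _] <-]; apply: ulimE_ge.
by apply: filterS filterT => n _ /=; exact: msr_ge0.
Qed.

Lemma loeb0 : loeb set0 = 0.
Proof.
apply/eqP; rewrite eq_le loeb_ge0 andbT.
apply: (@le_trans _ _ (ulimE U (fun n => msr (X n) set0))).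
  by apply: loeb_le => // n; exact: borel0.
apply: ulimE_le; apply: filterS filterT => n _ /=.
by have [_ [_ [-> _]]] := okX n.
Qed.

Lemma le_loeb : {homo loeb : A B / A `<=` B >-> A <= B}.
Proof.
move=> A B AB; apply: le_ereal_inf_tmp => _ [C [bC BC] <-].
by apply: loeb_le => //; exact: subset_trans BC.
Qed.

(* Countably many covers are merged along the diagonal: at stage [n] only the
   first [n] of them, and only those whose mass is already below its bound. *)
Lemma loeb_sigma_subadditive : sigma_subadditive loeb.
Proof.
move=> F; have [/existsNP[i /negP]|/contrapT Ffin] := pselect (~ forall i, loeb (F i) < +oo).
  rewrite -leNgt leye_eq => /eqP Fi.
  by rewrite (@nneseries_pinfty _ _ _ i) ?leey// => n _; exact: loeb_ge0.
apply/lee_addgt0Pr => e e0.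
apply: le_trans (epsilon_trick xpredT (fun n => loeb_ge0 (F n)) (ltW e0)).
pose c i := loeb (F i) + (e / (2 ^ i.+1)%:R)%:E.
have c_ge0 i : 0 <= c i by rewrite adde_ge0 ?loeb_ge0// lee_fin divr_ge0// ltW.
have /choice[C CP] i : exists C : forall n, set (car (X n)), [/\ forall n, borelX n (C n),
    F i `<=` internal C & U [set n | msr (X n) (C n) <= c i]].
  have : loeb (F i) < c i.
    by rewrite lteDl ?ge0_fin_numE ?loeb_ge0// lte_fin divr_gt0.
  move=> /ereal_inf_lt[_ [C [bC FC] <-]] /ulimE_lt lt_c.
  by exists C; split=> //; apply: filterS lt_c => n /=; exact: ltW.
pose G n i := if `[< msr (X n) (C i n) <= c i >] then C i n else set0.
have bG n i : borelX n (G n i).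
  by rewrite /G; case: asboolP => _; [have [] := CP i|exact: borel0].
have mG n i : msr (X n) (G n i) <= c i.
  by rewrite /G; case: asboolP => // _; have [_ [_ [-> _]]] := okX n.
apply: (@le_trans _ _ (ulimE U (fun n => msr (X n) (\big[setU/set0]_(i < n) G n i)))).
  apply: loeb_le => [n|x [i _ Fx]]; first exact: borel_bigsetU.
  have [_ FC ci] := CP i; have ni : U [set n | (i < n)%N] by apply: ooU; exists i.+1.
  apply: filterS (filterI (filterI (FC x Fx) ci) ni) => n /= [[Cx cn] lin].
  rewrite -bigcup_mkord; exists i => //; rewrite /G; case: asboolP => //.
apply: ulimE_le; apply: filterS filterT => n _ /=.
have [_ [_ mM]] := okX n; apply: le_trans (bmeasure_bigsetU_le mM n (bG n)) _.
apply: (@le_trans _ _ (\sum_(i < n) c i)); first exact: lee_sum.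
by rewrite -(big_mkord xpredT); apply: (@nneseries_lim_ge _ c) => i _ _.
Qed.

Definition loeb_measure : {outer_measure set S -> \bar R} :=
  HB.pack loeb (isOuterMeasure.Build R S loeb loeb0 loeb_ge0 le_loeb loeb_sigma_subadditive).

Lemma internal_setC (C : forall n, set (car (X n))) :
  ~` internal C = internal (fun n => ~` C n).
Proof.
apply/seteqP; split=> x /= nC; first exact: ultraN nC.
by move=> Cx; have [n []] := filter_ex (filterI Cx nC).
Qed.

(** An internal cover [B] of [A] splits, coordinate by coordinate, into internal covers of the two
    parts of [A], whose limit masses add up to at most that of [B]. *)
Lemma internal_caratheodory C : (forall n, borelX n (C n)) ->
  loeb_measure.-caratheodory (internal C).
Proof.
move=> bC; apply: le_caratheodory_measurable => A /=.
apply: le_ereal_inf_tmp => _ [B [bB AB] <-].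
have bI n : borelX n (B n `&` C n) by exact: borelI.
have bD n : borelX n (B n `\` C n) by exact: borelD.
have h1 : loeb (A `&` internal C) <= ulimE U (fun n => msr (X n) (B n `&` C n)).
  by apply: loeb_le => // x [/AB Bx Cx]; apply: filterS (filterI Bx Cx).
have h2 : loeb (A `&` ~` internal C) <= ulimE U (fun n => msr (X n) (B n `\` C n)).
  rewrite internal_setC; apply: loeb_le => // x [/AB Bx Cx]; exact: filterS (filterI Bx Cx).
apply: le_trans (leeD h1 h2) _.
apply: le_trans (ulimE_superadditive _ _) _ => [n|n|]; [exact: msr_ge0|exact: msr_ge0|].
apply: le_ulimE; apply: filterS filterT => n _ /=.
have [_ [_ mM]] := okX n; rewrite -(bmeasureU mM)//; first by rewrite setUIDK.
by apply/eqP/seteqP; split=> x // [[_ ?] []].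
Qed.

(** No internal cover beats [C] itself: if [C n] were not inside [B n] for [U]-most [n], choosing a
    point of the difference in each coordinate would give an element of [internal C] outside
    [internal B]. *)
Lemma loeb_internal C : (forall n, borelX n (C n)) ->
  loeb (internal C) = ulimE U (fun n => msr (X n) (C n)).
Proof.
move=> bC; apply/eqP; rewrite eq_le loeb_le//=.
apply: le_ereal_inf_tmp => _ [B [bB CB] <-]; apply: le_ulimE.
have [sCB|/ultraN nCB] := pselect (U [set n | C n `<=` B n]).
  by apply: filterS sCB => n /=; have [_ [_ mM]] := okX n; exact: (le_bmeasure mM).
have /dependent_choice_fun[x xP] n : exists x, ~ (C n `<=` B n) -> C n x /\ ~ B n x.
  have [CBn|/existsNP[x /not_implyP ?]] := pselect (C n `<=` B n); last by exists x.
  by exists (bpt (X n)).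
exfalso; have /CB Bx : internal C x by apply: filterS nCB => n /= /xP[].
by have [n [/= /xP[_ ?]]] := filter_ex (filterI nCB Bx).
Qed.

End Loeb.

(** * The ultraproduct of a sequence of pmm spaces *)

Section Ultraproduct.
Variables (R : realType) (X : nat -> pmm R) (U : set_system nat).

Local Notation S := (forall n, car (X n)).
Local Notation borelX n := (borel_on (dom (X n)) (@dst R (X n))).
Local Notation B r := (fun n => closed_ball (bpt (X n)) r).

Definition ubase : S := fun n => bpt (X n).
Definition uball (r : R) : set S := internal U (B r).
Definition ubounded : set S := [set x | exists r, uball r x].
Definition udist (x y : S) : R := ulim U (fun n => dst (x n) (y n)).
(* The quotient by [udist x y = 0] is modelled by a choice of representatives. *)
Definition urep (x : S) : S :=
  xget (ubase : {classic S}) [set y : {classic S} | ubounded y /\ udist x y = 0].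
Definition udom : set S := [set x | ubounded x /\ urep x = x].
Definition upush (Q : set S) (A : set S) : \bar R := loeb U (Q `&` urep @^-1` A).
Definition upmm : pmm R := PMM udom udist (urep ubase) (upush ubounded).
(** A point at limit distance exactly [r] from the base belongs to it only when some sequence
    representing it stays in the [r]-balls for [U]-most [n]. *)
Definition ustd (r : R) : set S := urep @` uball r.
Definition uball_pmm (r : R) : pmm R := sub_pmm (X := upmm) (ustd r) (upush (uball r)).

Context {UU : UltraFilter U}.
Hypothesis ooU : (\oo : set_system nat) `<=` U.
Hypothesis bcX : forall n, bcompact_pmm (X n).

Let okX n : pmm_ok (X n). Proof. by have [] := bcX n. Qed.

Let XM n : is_metric_on (dom (X n)) (@dst R (X n)). Proof. by have [] := okX n. Qed.
Let Xo n : dom (X n) (bpt (X n)). Proof. by have [_ []] := okX n. Qed.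
Let Xm n : is_borel_measure (dom (X n)) (@dst R (X n)) (msr (X n)).
Proof. by have [_ []] := okX n. Qed.

Lemma le_uball r s : r <= s -> uball r `<=` uball s.
Proof.
by move=> rs x xr; apply: filterS xr => n /= [Dx xr]; split=> //; exact: le_trans rs.
Qed.

Lemma uball_bounded r : uball r `<=` ubounded.
Proof. by move=> x xr; exists r. Qed.

Lemma ubase_uball r : 0 <= r -> uball r ubase.
Proof. by move=> r0; apply: filterS filterT => n _ /=; split=> //; rewrite (metxx (@XM n)). Qed.

Lemma ubounded_base : ubounded ubase.
Proof. by exists 0; exact: ubase_uball. Qed.

Lemma ubounded_dom x : ubounded x -> U [set n | dom (X n) (x n)].
Proof. by move=> [r xr]; apply: filterS xr => n /= []. Qed.

Lemma udistP x y : ubounded x -> ubounded y ->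
  ucvg U (fun n => dst (x n) (y n)) (udist x y).
Proof.
move=> [r xr] [s ys]; apply: (@ulimP _ _ _ _ (r + s)).
apply: filterS (filterI xr ys) => n /= [[Dx xr'] [Dy ys']].
rewrite ger0_norm; last exact: (met_ge0 (@XM n)).
have := met_triangle (@XM n) Dx (Xo n) Dy.
by rewrite (metC (@XM n) Dx (Xo n)); lra.
Qed.

Lemma udist_near x y e : ubounded x -> ubounded y -> 0 < e ->
  U [set n | [/\ dom (X n) (x n), dom (X n) (y n) &
                 `|dst (x n) (y n) - udist x y| < e]].
Proof.
move=> bx bY e0.
apply: filterS (filterI (filterI (ubounded_dom bx) (ubounded_dom bY)) (udistP bx bY e0)).
by move=> n /= [[]].
Qed.

Lemma udistxx x : ubounded x -> udist x x = 0.
Proof.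
move=> bx; apply: (ucvg_eq (udistP bx bx) (ucvg_cst 0)).
by apply: filterS (ubounded_dom bx) => n /= Dx; exact: (metxx (@XM n)).
Qed.

Lemma udistC x y : ubounded x -> ubounded y -> udist x y = udist y x.
Proof.
move=> bx bY; apply: (ucvg_eq (udistP bx bY) (udistP bY bx)).
apply: filterS (filterI (ubounded_dom bx) (ubounded_dom bY)) => n /= [Dx Dy].
exact: (metC (@XM n)).
Qed.

Lemma udist_triangle y x z : ubounded x -> ubounded y -> ubounded z ->
  udist x z <= udist x y + udist y z.
Proof.
move=> bx bY bz; apply: (ucvg_le (udistP bx bz) (ucvgD (udistP bx bY) (udistP bY bz))).
apply: filterS (filterI (filterI (ubounded_dom bx) (ubounded_dom bY)) (ubounded_dom bz)).
by move=> n /= [[Dx Dy] Dz]; exact: (met_triangle (@XM n)).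
Qed.

Lemma udist_ge0 x y : ubounded x -> ubounded y -> 0 <= udist x y.
Proof.
move=> bx bY; apply: (ucvg_le (ucvg_cst 0) (udistP bx bY)).
apply: filterS (filterI (ubounded_dom bx) (ubounded_dom bY)) => n /= [Dx Dy].
exact: (met_ge0 (@XM n)).
Qed.

Lemma udist_lt_uball x r : ubounded x -> udist ubase x < r -> uball r x.
Proof.
move=> bx xr; have e0 : 0 < r - udist ubase x by rewrite subr_gt0.
apply: filterS (udist_near ubounded_base bx e0) => n /= [_ Dx].
by rewrite ltr_norml => /andP[_ ?]; split=> //; rewrite /ubase in xr *; lra.
Qed.

Lemma uball_udist_le x r : uball r x -> udist ubase x <= r.
Proof.
move=> xr; apply: (ucvg_le (udistP ubounded_base (uball_bounded xr)) (ucvg_cst r)).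
by apply: filterS xr => n /= [].
Qed.

Lemma urepP x : ubounded x -> ubounded (urep x) /\ udist x (urep x) = 0.
Proof.
move=> bx; rewrite /urep; case: xgetP => [y _ //|/(_ x)]; case.
by split=> //; exact: udistxx.
Qed.

Lemma ubounded_rep x : ubounded x -> ubounded (urep x).
Proof. by move=> /urepP[]. Qed.

Lemma udist_repl x y : ubounded x -> ubounded y -> udist (urep x) y = udist x y.
Proof.
move=> bx bY; have [br xr] := urepP bx.
have := udist_triangle br bx bY; have := udist_triangle bx br bY.
by rewrite (udistC br bx) xr; lra.
Qed.

Lemma udist_repr x y : ubounded x -> ubounded y -> udist x (urep y) = udist x y.
Proof.
move=> bx bY; rewrite udistC//; last exact: ubounded_rep.
by rewrite udist_repl// udistC.
Qed.

Lemma urep_eq x y : ubounded x -> ubounded y -> udist x y = 0 -> urep x = urep y.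
Proof.
move=> bx bY xy; rewrite /urep.
(* [xget] depends only on the set it chooses from, so equivalent sequences get the same
   representative. *)
suff -> : [set z : {classic S} | ubounded z /\ udist x z = 0] =
          [set z : {classic S} | ubounded z /\ udist y z = 0] by [].
apply/seteqP; split=> z /= [bz z0]; split=> //.
  have := udist_triangle bY bx bz; have := udist_ge0 bY bz.
  by rewrite (udistC bY bx) xy z0; lra.
have := udist_triangle bx bY bz; have := udist_ge0 bx bz.
by rewrite xy z0; lra.
Qed.

Lemma udom_rep x : ubounded x -> udom (urep x).
Proof.
move=> bx; have [br xr] := urepP bx; split=> //.
by apply: urep_eq => //; rewrite udistC.
Qed.

Lemma udom_bounded : udom `<=` ubounded.
Proof. by move=> x []. Qed.

Lemma udist_metric : is_metric_on udom udist.
Proof.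
move=> x y z [bx rx] [bY ry] [bz rz]; split; last split.
- by split=> [/(urep_eq bx bY)|->]; [rewrite rx ry|exact: udistxx].
- exact: udistC.
- exact: udist_triangle.
Qed.

Lemma ustd_udom r : ustd r `<=` udom.
Proof. by move=> _ [x xr <-]; apply: udom_rep; exact: uball_bounded xr. Qed.

(* Countable saturation: a Cauchy sequence of internal points has a diagonal limit. *)
Lemma uball_complete r (x : nat -> S) : (forall k, uball r (x k)) ->
  (forall i j, (i <= j)%N -> udist (x i) (x j) <= 2^-1 ^+ i) ->
  exists2 l, uball r l & forall i, udist (x i) l <= 2 * 2^-1 ^+ i.
Proof.
move=> xr xC.
have bx k : ubounded (x k) by exact: uball_bounded (xr k).
(* The bound [2^-i] holds only for the limit distance; doubling it leaves room for it to hold at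
   [U]-most stages [n]. *)
pose ok n i j := (i <= j)%N -> B r n (x j n) /\ dst (x i n) (x j n) <= 2 * 2^-1 ^+ i.
pose good n k := forall i, (i < k.+1)%N -> forall j, (j < k.+1)%N -> ok n i j.
have Ugood k : U [set n | good n k].
  apply: filter_all_lt => i; apply: filter_all_lt => j.
  have [ij|ij] := leqP i j; last by apply: filterS filterT => n _; rewrite /ok leqNgt ij.
  have e0 : 0 < 2^-1 ^+ i :> R by rewrite exprn_gt0.
  apply: filterS (filterI (xr j) (udistP (bx i) (bx j) e0)) => n /= [xj].
  rewrite ltr_norml => /andP[_ h] _; split=> //; have := xC i j ij.
  by move: h; move: (2^-1 ^+ i) => q; lra.
(* At stage [n] the diagonal follows [x (m n)], where [m n] is the largest [k <= n] for which the
   first [k + 1] sequences behave well. The default [0] is taken when there is no such [k]. *)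
have /choice[m mP] n : exists m, forall k, (k <= n)%N -> good n k -> good n m /\ (k <= m)%N.
  have [[k kP]|nk] := pselect (exists k, (k <= n)%N && `[< good n k >]).
    have ub k' : (k' <= n)%N && `[< good n k' >] -> (k' <= n)%N by case/andP.
    case: (ex_maxnP (ex_intro _ k kP) ub) => m /andP[mn /asboolP gm] mmax.
    by exists m => k' k'n gk'; split=> //; apply: mmax; rewrite k'n; exact/asboolP.
  by exists 0%N => k kn gk; exfalso; apply: nk; exists k; rewrite kn; exact/asboolP.
have key i : U [set n | B r n (x (m n) n) /\ dst (x i n) (x (m n) n) <= 2 * 2^-1 ^+ i].
  have ni : U [set n | (i <= n)%N] by apply: ooU; exists i.
  apply: filterS (filterI ni (Ugood i)) => n /= [lin gi].
  have [gm im] := mP n i lin gi.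
  by apply: (gm i im (m n)).
exists (fun n => x (m n) n); first by apply: filterS (key 0%N) => n /= [].
move=> i; have bl : ubounded (fun n => x (m n) n).
  by exists r; apply: filterS (key 0%N) => n /= [].
apply: (ucvg_le (udistP (bx i) bl) (ucvg_cst _)).
by apply: filterS (key i) => n /= [].
Qed.

Lemma ustd_closed r l : udom l -> (forall e, 0 < e -> exists2 x, ustd r x & udist x l < e) ->
  ustd r l.
Proof.
move=> [bl rl] lP.
(* With precision [2^-(k+1)], two terms of index at least [i] differ by at most [2^-i], as
   [uball_complete] asks. *)
have /choice[x xP] k : exists x, uball r x /\ udist x l < 2^-1 ^+ k.+1.
  have [|_ [x xr <-] xl] := lP (2^-1 ^+ k.+1); first by rewrite exprn_gt0.
  by exists x; split=> //; rewrite -udist_repl//; exact: uball_bounded xr.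
have bx k : ubounded (x k) by exact: uball_bounded (xP k).1.
have [k|i j ij|l' l'r l'P] := @uball_complete r x; first by have [] := xP k.
  have := udist_triangle (bx i) bl (bx j); have := (xP i).2; have := (xP j).2.
  rewrite (udistC bl (bx j)) !exprS.
  have : 2^-1 ^+ j <= 2^-1 ^+ i :> R by rewrite ler_wiXn2l// invf_le1 ?ler1n.
  by move: (2^-1 ^+ i) (2^-1 ^+ j) => p q; lra.
exists l' => //; have bl' := uball_bounded l'r; rewrite -rl; apply: urep_eq => //.
apply/eqP; rewrite eq_le udist_ge0// andbT; apply/ler_addgt0Pr => e e0; rewrite add0r.
have h : `|2^-1 : R| < 1 by rewrite ger0_norm// invf_lt1// ltr1n.
have /cvgr0Pnorm_lt/(_ _ e0)[j _ /(_ j (leqnn j)) jP] := cvg_geometric 3 h.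
have := udist_triangle bl' (bx j) bl; rewrite (udistC bl' (bx j)).
have := l'P j; have := (xP j).2; move: (le_lt_trans (ler_norm _) jP).
have : 0 <= 2^-1 ^+ j :> R by rewrite exprn_ge0.
by rewrite /geometric /= exprS; move: (2^-1 ^+ j) => q; lra.
Qed.


(** * Finite nets of the ultraproduct and the internal sets they generate *)

Hypothesis Xnet : forall r e : R, 0 <= r -> 0 < e ->
  exists N, forall n, has_net (X n) r e N.
Hypothesis Xmass : forall r : R, 0 <= r ->
  exists M : R, forall n, (msr (X n) (closed_ball (bpt (X n)) r) <= M%:E)%E.

(** The net has [N.+1] points, the first being the base point, so that a gluing along the net also
    controls the distance of the base points. *)
Definition is_unet (r e : R) (N : nat) (c : nat -> S) :=
  [/\ c 0%N = ubase, forall i n, B r n (c i n) &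
      forall n x, B r n x -> exists2 i, (i < N.+1)%N & dst x (c i n) < e].

Lemma unet_exists r e : 0 <= r -> 0 < e -> exists N c, is_unet r e N c.
Proof.
move=> r0 e0; have [N /dependent_choice_fun[c cP]] := Xnet r0 e0.
exists N, (fun i n => if i is j.+1 then c n j else bpt (X n)); split=> // [[|i] n|n x xr].
- by split=> //; rewrite (metxx (@XM n)).
- by have [] := cP n.
- by have [_ /(_ x xr)[i iN xi]] := cP n; exists i.+1.
Qed.

(** The part of [B_r(X n)] covered by the closed [e]-balls around the net points selected by [J]. It
    is Borel, and for fixed [N] there are finitely many such sets, which stand in for arbitrary
    closed sets. *)
Definition unet_part (r e : R) (N : nat) (c : nat -> S) (J : nat -> Prop) n :=
  [set y | B r n y /\ exists i, [/\ (i < N.+1)%N, J i & dst (c i n) y <= e]].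

Arguments unet_part : clear implicits.

Section Net.
Variables (r e : R) (N : nat) (c : nat -> S).
Hypotheses (e0 : 0 < e) (cN : is_unet r e N c).

Lemma unet_uball i : uball r (c i).
Proof. by case: cN => _ cr _; apply: filterS filterT => n _ /=. Qed.

Lemma unet_bounded i : ubounded (c i).
Proof. exact: uball_bounded (unet_uball i). Qed.

Lemma unet_part_borel J n : borelX n (unet_part r e N c J n).
Proof.
case: cN => _ cr _.
pose F i := if `[< J i >] then closed_ball (c i n) e else set0.
have -> : unet_part r e N c J n = B r n `&` \big[setU/set0]_(i < N.+1) F i.
  rewrite -bigcup_mkord /F; apply/seteqP; split=> y /= [yr].
    move=> [i [iN Ji yi]]; split=> //; exists i => //=.
    by case: asboolP => // _; split=> //; case: yr.
  by move=> [i /= iN]; case: asboolP => // Ji [_ yi]; split=> //; exists i.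
apply: borelI; first exact: borel_closed_ball.
apply: borel_bigsetU => i; rewrite /F.
by case: asboolP => _; [apply: borel_closed_ball => //; case: (cr i n)|exact: borel0].
Qed.

Lemma unet_near x : ubounded x ->
  U [set n | dom (X n) (x n) /\
     forall i, (i < N.+1)%N -> `|dst (x n) (c i n) - udist x (c i)| < e].
Proof.
move=> bx; apply: filterI; first exact: ubounded_dom.
by apply: filter_all_lt => i; exact: (udistP bx (unet_bounded i)).
Qed.

(** Some stage [n] has [x n] in the set and all its distances to the net within [e] of their limits;
    the index found there works, at the cost of [e] for the ball and [e] for the limit. The converse
    [unet_partI] loses [2 * e] likewise. *)
Lemma unet_partE J x : ubounded x -> internal U (unet_part r e N c J) x ->
  exists i, [/\ (i < N.+1)%N, J i & udist x (c i) < 2 * e].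
Proof.
move=> bx xJ; have [n [[/= _ [i [iN Ji xi]]] [Dx h]]] := filter_ex (filterI xJ (unet_near bx)).
exists i; split=> //; have := h i iN; rewrite (metC (@XM n) Dx) ?ltr_norml; first by lra.
by case: cN => _ /(_ i n)[].
Qed.

Lemma unet_partI (J : nat -> Prop) x : uball r x ->
  (forall i, (i < N.+1)%N -> udist x (c i) < 2 * e -> J i) ->
  internal U (unet_part r e N c J) x.
Proof.
move=> xr xJ; have bx := uball_bounded xr; case: cN => _ cr cP.
apply: filterS (filterI xr (unet_near bx)) => n /= [xn [Dx h]]; split=> //.
have [i iN xi] := cP n _ xn; exists i; split=> //.
  by apply: xJ => //; have := h i iN; rewrite ltr_norml; lra.
by rewrite (metC (@XM n)) 1?ltW//; case: (cr i n).
Qed.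

Lemma unet_close x : uball r x -> exists2 i, (i < N.+1)%N & udist x (c i) < 2 * e.
Proof.
move=> xr; have [i [iN _ xi]] := @unet_partE (fun=> True) x (uball_bounded xr)
  (@unet_partI (fun=> True) x xr (fun _ _ _ => Logic.I)).
by exists i.
Qed.

End Net.

(** Total boundedness comes from the uniform nets and completeness from [uball_complete], both
    applied to sequences in [uball r] and carried over to their representatives. *)
Lemma ucompact K r : 0 <= r -> K `<=` ustd r ->
  (forall l, udom l -> (forall e, 0 < e -> exists2 x, K x & udist x l < e) -> K l) ->
  compact_in udom udist K.
Proof.
move=> r0 Kr Kcl; have KD := subset_trans Kr (@ustd_udom r).
apply: complete_totally_bounded_compact => //; first exact: udist_metric.
  move=> e e0; have e2 : 0 < e / 2 by rewrite divr_gt0.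
  have [N [c cN]] := unet_exists r0 e2.
  exists N.+1, (fun i => urep (c i)); split=> [i|_ /Kr[x xr <-]].
    exact/udom_rep/(unet_bounded cN).
  have bx := uball_bounded xr; have [i iN xi] := unet_close e2 cN xr.
  exists i => //; have bc := unet_bounded cN i; have br := ubounded_rep bc.
  by rewrite udist_repl// udist_repr//; lra.
move=> x Kx xC.
have /choice[y yP] k : exists y, uball r y /\ urep y = x k.
  by have [y yr yx] := Kr _ (Kx k); exists y.
have by_ k : ubounded (y k) by exact: uball_bounded (yP k).1.
have [k|i j ij|l lr lP] := @uball_complete r y; first by have [] := yP k.
  have := xC i j ij; rewrite -(yP i).2 -(yP j).2 udist_repl//; last exact: ubounded_rep.
  by rewrite udist_repr.
have bl := uball_bounded lr.
have xl i : udist (x i) (urep l) <= 2 * 2^-1 ^+ i.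
  rewrite -(yP i).2 udist_repl//; last exact: ubounded_rep.
  by rewrite udist_repr.
exists (urep l) => //; apply: Kcl => [|e e0]; first exact: udom_rep.
have h : `|2^-1 : R| < 1 by rewrite ger0_norm// invf_lt1// ltr1n.
have /cvgr0Pnorm_lt/(_ _ e0)[j _ /(_ j (leqnn j)) jP] := cvg_geometric 2 h.
by exists (x j) => //; apply: le_lt_trans (xl j) (le_lt_trans (ler_norm _) jP).
Qed.

Lemma ustd_open_compl r : open_in udom udist (udom `\` ustd r).
Proof.
split=> [x []//|x [Dx nx]]; apply: contrapT => ne; apply: nx.
apply: ustd_closed => // e e0; apply: contrapT => ny; apply: ne.
exists e => // y Dy xy; split=> // yr; apply: ny; exists y => //.
by rewrite udistC//; exact: udom_bounded.
Qed.

Lemma ustd_compact r : 0 <= r -> compact_in (ustd r) udist (ustd r).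
Proof.
move=> r0; apply: compact_in_restr (@ustd_udom r) (@ustd_open_compl r) _.
by apply: (ucompact r0) => // l; exact: ustd_closed.
Qed.

(** * Measurability of the passage to representatives, and the push-forward measure *)

Section PushForward.
Variables (Q D : set S).
Hypotheses (mQ : (loeb_measure ooU okX).-caratheodory Q) (bQ : Q `<=` ubounded).
Hypotheses (QD : forall x, Q x -> D (urep x)) (DL : D `<=` udom).

(** A closed set is the intersection of its neighbourhoods, and here neighbourhoods can be taken
    internal: [W s j] is generated by the points of a [1/(j+1)]-net of the [s]-balls that lie within
    [2/(j+1)] of [F]. The union over [s] accounts for [Q] being merely contained in the bounded
    sequences. *)
Let F_preimage F : F `<=` D -> open_in D udist (D `\` F) ->
  (loeb_measure ooU okX).-caratheodory (Q `&` urep @^-1` F).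
Proof.
move=> FD oF; pose e (j : nat) : R := j.+1%:R^-1.
have e0 j : 0 < e j by rewrite invr_gt0.
have /choice[Nc NcP] (p : nat * nat) : exists Nc, is_unet p.1%:R (e p.2) Nc.1 Nc.2.
  by have [N [c cN]] := unet_exists (ler0n R p.1) (e0 p.2); exists (N, c).
pose J s j i := exists2 a, F a & udist a ((Nc (s, j)).2 i) < 2 * e j.
pose W s j := unet_part s%:R (e j) (Nc (s, j)).1 (Nc (s, j)).2 (J s j).
have -> : Q `&` urep @^-1` F = Q `&` \bigcup_s ~` \bigcup_j ~` internal U (W s j).
  apply/seteqP; split=> x [Qx xF]; split=> //=.
    have [r xr] := bQ Qx; have [s rs] : exists s : nat, r <= s%:R.
      by exists (Num.bound `|r|); apply: le_trans (ler_norm _) (ltW (archi_boundP _)).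
    exists s => //= -[j _]; apply; apply: (unet_partI (e0 j) (NcP (s, j))).
      exact: le_uball xr.
    move=> i iN xi; exists (urep x) => //; rewrite udist_repl//; first exact: bQ.
    exact: (unet_bounded (NcP (s, j))).
  case: xF => s _ /= xW; apply: contrapT => nF.
  have bx := bQ Qx; have br := ubounded_rep bx.
  have [_ /(_ (urep x) (conj (QD Qx) nF))[d d0 dP]] := oF.
  (* Both [x] and a point of [F] are within [2 * e j] of the same net point. *)
  have [j jd] : exists j, 4 * e j < d.
    have := ltr_add_invr (_ : 0 < d / 4); rewrite divr_gt0// => /(_ isT)[j].
    by rewrite add0r => h; exists j; move: h; rewrite /e; move: (j.+1%:R^-1) => q; lra.
  have xWj : internal U (W s j) x by apply: contrapT => h; apply: xW; exists j.
  have [i [iN [a Fa ai] xi]] := unet_partE (e0 j) (NcP (s, j)) bx xWj.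
  have ba : ubounded a by exact/udom_bounded/DL/FD.
  have bc := unet_bounded (NcP (s, j)) i.
  have [|_ /(_ Fa)//] := dP a (FD _ Fa).
  rewrite udist_repl//; have := udist_triangle bx bc ba.
  by rewrite (udistC bc ba); lra.
apply: caratheodory_measurable_setI => //; apply: caratheodory_measurable_bigcup => s.
apply: caratheodory_measurable_setC; apply: caratheodory_measurable_bigcup => j.
apply: caratheodory_measurable_setC; apply: internal_caratheodory => n.
exact: unet_part_borel (NcP (s, j)) _ _.
Qed.

Lemma borel_preimage_caratheodory A : borel_on D udist A ->
  (loeb_measure ooU okX).-caratheodory (Q `&` urep @^-1` A).
Proof.
move: A; apply: borel_sub_sigma_algebra => [|A oA].
  split=> [|A mA|F mF] /=.
  - by rewrite preimage_set0 setI0; exact: (caratheodory_measurable_set0 (loeb_measure ooU okX)).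
  - have -> : Q `&` urep @^-1` (D `\` A) = Q `\` (Q `&` urep @^-1` A).
      apply/seteqP; split=> x /= [Qx]; first by move=> [_ nA]; split=> // -[].
      by move=> nA; split=> //; split=> [|Ax]; [exact: QD|exact: nA].
    exact: (@caratheodory_measurable_setD _ _ (loeb_measure ooU okX) _ _ mQ mA).
  - rewrite preimage_bigcup setI_bigcupr.
    exact: (@caratheodory_measurable_bigcup _ _ (loeb_measure ooU okX)).
have -> : Q `&` urep @^-1` A = Q `\` (Q `&` urep @^-1` (D `\` A)).
  apply/seteqP; split=> x /= [Qx]; first by move=> Ax; split=> // -[_ [_]].
  move=> nA; split=> //; apply: contrapT => nAx; apply: nA; split=> //.
  by split=> //; exact: QD.
apply: caratheodory_measurable_setD => //; apply: F_preimage; first by move=> x [].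
by rewrite setDD setIidr//; exact: oA.1.
Qed.

Lemma upush_is_borel_measure : is_borel_measure D udist (upush Q).
Proof.
split; first by rewrite /upush preimage_set0 setI0 loeb0.
split=> [A _|F bF tF]; first exact: loeb_ge0.
rewrite /upush preimage_bigcup setI_bigcupr.
apply: (@caratheodory_sigma_additive _ _ (loeb_measure ooU okX) (fun n => Q `&` urep @^-1` F n)).
  by move=> n; exact: borel_preimage_caratheodory.
by apply/trivIsetP => i j _ _ ij; rewrite setIACA -preimage_setI;
  move/trivIsetP : tF => -> //; rewrite preimage_set0 setI0.
Qed.

End PushForward.

(** * The limit spaces and their approximation by the spaces [X n] *)

Lemma uball_borel r n : borelX n (B r n).
Proof. exact: borel_closed_ball. Qed.

Lemma uball_caratheodory r : (loeb_measure ooU okX).-caratheodory (uball r).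
Proof. by apply: internal_caratheodory => n; exact: uball_borel. Qed.

Lemma ubounded_caratheodory : (loeb_measure ooU okX).-caratheodory ubounded.
Proof.
have -> : ubounded = \bigcup_(s : nat) uball s%:R.
  apply/seteqP; split=> x; last by move=> [s _ xs]; exists s%:R.
  move=> [r xr]; exists (Num.bound `|r|) => //; apply: le_uball xr.
  exact: le_trans (ler_norm _) (ltW (archi_boundP _)).
by apply: caratheodory_measurable_bigcup => s; exact: uball_caratheodory.
Qed.

Lemma ulimE_mass r C : 0 <= r -> (forall n, borelX n (C n)) -> (forall n, C n `<=` B r n) ->
  ulimE U (fun n => msr (X n) (C n)) \is a fin_num.
Proof.
move=> r0 bC CB; have [M MP] := Xmass r0; rewrite ge0_fin_numE.
  apply: le_lt_trans (ltry M); apply: ulimE_le; apply: filterS filterT => n _ /=.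
  by apply: le_trans (MP n); apply: (le_bmeasure (@Xm n)) => //; exact: uball_borel.
apply: ulimE_ge; apply: filterS filterT => n _ /=; exact: (bmeasure_ge0 (@Xm n)).
Qed.

Lemma loeb_uball_lty r : 0 <= r -> (loeb U (uball r) < +oo)%E.
Proof.
move=> r0; rewrite loeb_internal//; last by move=> n; exact: uball_borel.
have := ulimE_mass r0 (uball_borel r) (fun n => @subset_refl _ _).
by rewrite fin_numE => /andP[_]; rewrite -ltey.
Qed.

Lemma udist_base_rep x : ubounded x -> udist (urep ubase) x = udist ubase x.
Proof. by move=> bx; apply: udist_repl => //; exact: ubounded_base. Qed.

Lemma upmm_bcompact : bcompact_pmm upmm.
Proof.
split; first (split; [|split]).
- exact: udist_metric.
- exact/udom_rep/ubounded_base.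
- apply: upush_is_borel_measure => //; first exact: ubounded_caratheodory.
  exact: udom_rep.
move=> x r Dx; have [bx _] := Dx.
(* The extra [1] makes the inequality required by [udist_lt_uball] strict; the absolute value keeps
   [t] nonnegative when [r] is negative. *)
pose t := `|udist ubase x + r| + 1; have t0 : 0 <= t by rewrite addr_ge0.
have ball_t y : ubounded y -> udist x y <= r -> uball t y.
  move=> bY xy; apply: udist_lt_uball => //.
  have := udist_triangle ubounded_base bx bY; have := ler_norm (udist ubase x + r).
  by rewrite /t; lra.
split.
  apply: (ucompact t0) => [y [[bY ry] xy]|l Dl lP].
    by exists y => //; exact: ball_t.
  split=> //; apply/ler_addgt0Pr => e e0; have [y [[bY ry] xy] yl] := lP e e0.
  have := udist_triangle bx bY Dl.1; rewrite /= in xy *; lra.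
apply: le_lt_trans (loeb_uball_lty t0); apply: (@le_loeb _ _ _) => y [bY [_ /=]].
by rewrite udist_repr//; exact: ball_t.
Qed.

Lemma uball_pmm_compact r : 0 <= r -> compact_pmm (uball_pmm r).
Proof.
move=> r0; split; [split; [|split]|split].
- exact: (is_metric_on_sub udist_metric (@ustd_udom r)).
- by exists ubase => //; exact: ubase_uball.
- apply: upush_is_borel_measure.
  + exact: uball_caratheodory.
  + exact: uball_bounded.
  + by move=> x xr; exists x.
  + exact: ustd_udom.
- exact: ustd_compact.
- by apply: le_lt_trans (loeb_uball_lty r0); apply: (@le_loeb _ _ _) => y [].
Qed.

(** Limit distance at most [r - e] is strictly less than [r], which forces the sequence into the
    [r]-balls for [U]-most [n]. The gap [e] in the definition of [a_fun] supplies this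
    strictness. *)
Lemma uball_pmm_ge r e : 0 < e ->
  pmm_le (X := upmm) (closed_ball (bpt upmm) (r - e))
    (fun A => msr upmm (A `&` closed_ball (bpt upmm) (r - e))) (ustd r) (upush (uball r)).
Proof.
move=> e0; have sub x : ubounded x -> udist ubase x <= r - e -> uball r x.
  by move=> bx xr; apply: udist_lt_uball => //; lra.
split=> [x [[bx rx] /=]|A _].
  by rewrite udist_base_rep// => xr; exists x => //; exact: sub.
apply: (@le_loeb _ _ _) => x [bx [Ax [_ /=]]]; rewrite udist_base_rep; last exact: ubounded_rep.
by rewrite udist_repr//; [move=> xr; split=> //; exact: sub|exact: ubounded_base].
Qed.

Lemma uball_pmm_le r : pmm_le (X := upmm) (ustd r) (upush (uball r)) (dom upmm) (msr upmm).
Proof.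
split; first exact: ustd_udom.
by move=> A _; apply: (@le_loeb _ _ _) => x [xr Ax]; split=> //; exact: uball_bounded xr.
Qed.

(** For [U]-most [n], the finitely many net distances and the finitely many masses of the sets [W I]
    are all within [h] of their limits; gluing along the net then compares everything. The maps
    embed the whole of [X n] and of [upmm], so the result serves for comparing the [s]-balls with
    [uball_pmm s] and with smaller balls of [upmm]. *)
Lemma uball_approx s e : 0 <= s -> 0 < e ->
  U [set n | exists (Z : mspace R) (f : car (X n) -> mcar Z) (g : S -> mcar Z),
    [/\ is_metric Z,
        (forall x y, dom (X n) x -> dom (X n) y -> mdst (f x) (f y) = dst x y),
        (forall x y, udom x -> udom y -> mdst (g x) (g y) = udist x y),
        mdst (f (bpt (X n))) (g (urep ubase)) <= e &
    [/\ forall x, B s n x -> exists2 y, ustd s y & mdst (f x) (g y) < e,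
        forall y, ustd s y -> exists2 x, B s n x & mdst (f x) (g y) < e &
        forall A, mclosed A ->
        (msr (X n) (B s n `&` f @^-1` A) <=
           loeb U (uball s `&` [set x | nbhd_eps A e (g (urep x))]) + e%:E)%E /\
        (loeb U (uball s `&` [set x | A (g (urep x))]) <=
           msr (X n) (B s n `&` f @^-1` nbhd_eps A e) + e%:E)%E]]].
Proof.
(* Points near the same net point end up less than [4 * h] apart in the glued space ([h] in [X n],
   [h] for the crossing, [2 * h] in [upmm]), so [8 * h] leaves room. *)
move=> s0 e0; have [h h0 he] : exists2 h, 0 < h & e = 8 * h.
  by exists (e / 8); [rewrite divr_gt0|lra].
have [N [c cN]] := unet_exists s0 h0; have [c0 cB cP] := cN.
have bc := unet_bounded cN.
pose W (I : {set 'I_N.+1}) := unet_part s h N c (fun i => inord i \in I).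
have bW I n : borelX n (W I n) by exact: (unet_part_borel cN).
have cond1 : U [set n | forall i, (i < N.+1)%N -> forall j, (j < N.+1)%N ->
    `|dst (c i n) (c j n) - udist (c i) (c j)| < h].
  by apply: filter_all_lt => i; apply: filter_all_lt => j; exact: (udistP (bc i) (bc j)).
have cond2 : U [set n | forall I : {set 'I_N.+1},
    (msr (X n) (W I n) <= loeb U (internal U (W I)) + h%:E)%E /\
    (loeb U (internal U (W I)) <= msr (X n) (W I n) + h%:E)%E].
  apply: filter_forall => I; rewrite loeb_internal//.
  have lfin : ulimE U (fun n => msr (X n) (W I n)) \is a fin_num.
    by apply: (ulimE_mass s0) => // n x [].
  set l := ulimE _ _ in lfin *.
  have h1 : U [set n | msr (X n) (W I n) < l + h%:E]%E.
    by apply: ulimE_lt; rewrite -/l lteDl// lte_fin.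
  have h2 : U [set n | l - h%:E < msr (X n) (W I n)]%E.
    by apply: ulimE_gt; rewrite -/l lteBlDr// lteDl// lte_fin.
  apply: filterS (filterI h1 h2) => n /= [/ltW a1 /ltW a2]; split=> //.
  by rewrite -leeBlDr.
apply: filterS (filterI cond1 cond2) => n /= [cn Wn].
have [Z [f [g [ZM fI gI fg]]]] := @metric_glue R _ _ _ _ _ _ (@XM n) udist_metric N
  (fun i => c i n) (fun i => urep (c i)) h (fun i => (cB i n).1)
  (fun i => udom_rep (bc i)) h0 ltac:(by move=> i j; rewrite udist_repl ?udist_repr//;
     [apply: le_trans (ltW (cn i (ltn_ord i) j (ltn_ord j))) _;
      by rewrite ler_peMl ?ler1n// ltW|exact: ubounded_rep]).
have zc i : (i < N.+1)%N -> mdst (f (c i n)) (g (urep (c i))) <= h.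
  by move=> iN; exact: (fg (Ordinal iN)).
have close x y i : dom (X n) x -> ubounded y -> (i < N.+1)%N -> dst (c i n) x <= h ->
    udist y (c i) < 2 * h -> mdst (f x) (g (urep y)) < e.
  move=> Dx bY iN xi yi; have [Dc _] := cB i n.
  have := zdist_triangle ZM (f (c i n)) (f x) (g (urep y)).
  have := zdist_triangle ZM (g (urep (c i))) (f (c i n)) (g (urep y)).
  rewrite (zdistC ZM (f x) (f (c i n))) fI// gI; [|exact: udom_rep|exact: udom_rep].
  rewrite udist_repl//; last exact: ubounded_rep.
  by rewrite udist_repr// (udistC (bc i) bY) he; have := zc i iN; lra.
exists Z, f, g; split=> //.
  have := zc 0%N isT; rewrite c0 /ubase; lra.
have sB x : B s n x -> exists2 i, (i < N.+1)%N & dst (c i n) x <= h.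
  move=> xs; have [i iN xi] := cP n x xs; exists i => //.
  by rewrite (metC (@XM n)) 1?ltW//; [case: (cB i n)|case: xs].
split.
- move=> x xs; have [i iN xi] := sB x xs; exists (urep (c i)).
    by exists (c i) => //; exact: unet_uball cN i.
  by apply: (close x (c i) i) => //; [case: xs|rewrite udistxx//; lra].
- move=> _ [y yr <-]; have [i iN yi] := unet_close h0 cN yr.
  exists (c i n) => //; apply: (close _ _ i) => //.
  + by case: (cB i n).
  + exact: uball_bounded yr.
  + by rewrite (metxx (@XM n)) 1?ltW//; case: (cB i n).
have bI A : borelX n (dom (X n) `&` A) -> borelX n (B s n `&` A).
  move=> bA; have -> : B s n `&` A = B s n `&` (dom (X n) `&` A).
    by rewrite setIA; congr (_ `&` _); apply/esym/setIidl => x [].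
  by apply: borelI => //; exact: uball_borel.
move=> A cA; split.
(* [I] collects the net points near the trace of [A]: the trace lies in [W I n], and every element
   of the internal set of [W I] is sent into the [e]-neighbourhood of [A]. The set [J] below does
   the same with the two spaces exchanged. *)
- pose I : {set 'I_N.+1} := finset (fun i : 'I_N.+1 =>
    `[< exists x, [/\ B s n x, A (f x) & dst (c i n) x <= h] >]).
  apply: (@le_trans _ _ (msr (X n) (W I n))).
    apply: (le_bmeasure (@Xm n)) => //.
      by apply: bI; exact: (borel_preimage_closed fI cA).
    move=> x [xs Ax]; have [i iN xi] := sB x xs; split=> //; exists i; split=> //.
    by rewrite inE; apply/asboolP; exists x; rewrite inordK.
  apply: le_trans (Wn I).1 _; apply: leeD; last by rewrite lee_fin; lra.
  apply: (@le_loeb _ _ _) => x xW; have xs : uball s x by apply: filterS xW => k [].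
  have bx := uball_bounded xs; split=> //.
  have [i [iN + xi]] := unet_partE h0 cN bx xW.
  rewrite inE => /asboolP[y]; rewrite inordK// => -[ys Ay yi].
  exists (f y) => //; rewrite zdistC//; apply: (close _ _ i) => //; by case: ys.
- pose J : {set 'I_N.+1} := finset (fun i : 'I_N.+1 =>
    `[< exists x, [/\ uball s x, A (g (urep x)) & udist x (c i) < 2 * h] >]).
  apply: (@le_trans _ _ (loeb U (internal U (W J)))).
    apply: (@le_loeb _ _ _) => x [xs Ax]; apply: (unet_partI h0 cN) => // i iN xi.
    by rewrite inE; apply/asboolP; exists x; rewrite inordK.
  apply: le_trans (Wn J).2 _; apply: leeD; last by rewrite lee_fin; lra.
  apply: (le_bmeasure (@Xm n)) => //.
    by apply: bI; exact: (borel_preimage_nbhd ZM fI).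
  move=> y [ys [i [iN + yi]]]; rewrite inE => /asboolP[x]; rewrite inordK// => -[xs Ax xi].
  split=> //; exists (g (urep x)) => //; apply: (close _ _ i) => //; first by case: ys.
  exact: uball_bounded xs.
Qed.

Lemma uball_pmm_approx r e : 0 <= r -> 0 < e ->
  U [set n | (dGHPc (ball_pmm (X n) r) (uball_pmm r) <= e%:E)%E].
Proof.
move=> r0 e0; apply: filterS (uball_approx r0 e0) => n /=.
move=> [Z [f [g [ZM fI gI oo [XY YX mA]]]]].
have eX A : pushf (X := ball_pmm (X n) r) f A = msr (X n) (B r n `&` f @^-1` A).
  by rewrite /pushf /= setIAC setIid.
have eL A : pushf (X := uball_pmm r) g A = loeb U (uball r `&` [set x | A (g (urep x))]).
  congr loeb; apply/seteqP; split=> x [xr /=]; first by case.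
  by move=> Ax; split=> //; split=> //; exists x.
apply: (@dGHPc_le _ (ball_pmm (X n) r) (uball_pmm r) Z f g) => //.
- by move=> x y [Dx _] [Dy _]; exact: fI.
- by move=> x y /ustd_udom Dx /ustd_udom Dy; exact: gI.
- by move=> A cA; rewrite !eX !eL; exact: mA.
Qed.

(** As [s] decreases to [r], the sets [uball s] shrink to one in which all limit distances are at
    most [r]; this settles the mass by continuity from above. The metric part follows from
    compactness of the closed ball of radius [r + 1]. *)
Lemma upmm_thin_shell r e : 0 <= r -> 0 < e -> exists s, [/\ r < s,
  (loeb U (uball s `&` [set x | (r < udist ubase x)%R]) <= e%:E)%E &
  forall y, ustd s y -> exists2 y', closed_ball (bpt upmm) r y' & udist y y' < e].
Proof.
move=> r0 e0; pose s (k : nat) : R := r + k.+1%:R^-1.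
have inv0 (k : nat) : 0 < k.+1%:R^-1 :> R by rewrite invr_gt0.
have sle i j : (i <= j)%N -> s j <= s i.
  by move=> ij; rewrite lerD2l lef_pV2 ?posrE// ler_nat ltnS.
have s1 : s 0%N = r + 1 by rewrite /s invr1.
have [k1 k1P] : exists k, forall j, (k <= j)%N ->
    (loeb U (uball (s j) `&` [set x | (r < udist ubase x)%R]) <= e%:E)%E.
  have [||| k kP] := @caratheodory_continuity _ _ (loeb_measure ooU okX) ubase
      (fun k => uball (s k)) e e0.
  - by move=> n; exact: uball_caratheodory.
  - by move=> n m nm; apply: le_uball; exact: sle.
  - by apply: loeb_uball_lty; rewrite s1 addr_ge0.
  exists k => j kj; apply: le_trans (kP j kj); apply: (@le_loeb _ _ _) => x [xs rx].
  split=> // xI; suff : udist ubase x <= r by rewrite leNgt rx.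
  apply/ler_addgt0Pr => d d0; have [i] := ltr_add_invr d0; rewrite add0r => id.
  have := uball_udist_le (xI i Logic.I); rewrite /s => h.
  by apply: le_trans h _; rewrite lerD2l ltW.
have [k2 k2P] : exists k, forall j, (k <= j)%N ->
    forall y, ustd (s j) y -> exists2 y', closed_ball (bpt upmm) r y' & udist y y' < e.
  have [_ cB] := upmm_bcompact; have Dbase := udom_rep ubounded_base.
  have [[_ {}cB] _] := cB _ (r + 1) Dbase.
  (* [V 0] is the [e]-neighbourhood of the [r]-ball and [V k.+1] the exterior of the [s k]-ball.
     Once [s j] is below the radii in a finite subcover, a point within [s j] can only be in
     [V 0]. *)
  pose V i := if i is k.+1 then [set y | udom y /\ s k < udist (urep ubase) y]
    else [set y | udom y /\ exists2 a, closed_ball (bpt upmm) r a & udist y a < e].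
  have [||F /finite_set_nat_bound[K FK] VF] := cB nat V.
  - case=> [|k] /=.
      split=> [y []//|y [Dy [a [Da ar] ya]]]; exists (e - udist y a); first by rewrite subr_gt0.
      move=> z Dz yz; split=> //; exists a => //.
      have := met_triangle udist_metric Dz Dy Da.
      by rewrite (metC udist_metric Dz Dy); lra.
    split=> [y []//|y [Dy yk]].
    have [|_ hV] := @open_in_ball_compl _ _ _ _ (urep ubase) (s k) udist_metric => //.
    have [|d d0 dP] := hV y; first by split=> // -[_]; rewrite leNgt yk.
    exists d => // z Dz yz; have [_ nz] := dP z Dz yz; split=> //.
    by rewrite ltNge; apply/negP => zk; apply: nz.
  - move=> y [Dy _]; have [yr|ry] := leP (udist (urep ubase) y) r.
      by exists 0%N => //; split=> //; exists y; [|rewrite udistxx//; exact: udom_bounded].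
    have [k] := ltr_add_invr ry; rewrite -/(s k) => yk.
    by exists k.+1.
  exists K => j Kj y ys; have Dy := ustd_udom ys.
  have yj : udist (urep ubase) y <= s j.
    case: ys => x xs <-; have bx := uball_bounded xs.
    rewrite udist_base_rep ?udist_repr;
      by [exact: uball_udist_le|exact: ubounded_base| |exact: ubounded_rep].
  have [|[|k] Fk /=] := VF y; first by split=> //; apply: le_trans yj _; rewrite -s1 sle.
    by move=> [].
  move=> [_ yk]; have := lt_le_trans yk yj; rewrite ltNge sle//.
  by apply: leq_trans Kj; apply: leq_trans (FK _ Fk).
exists (s (maxn k1 k2)); split.
- by rewrite ltrDl.
- by apply: k1P; exact: leq_maxl.
- by apply: k2P; exact: leq_maxr.
Qed.

(** Enlarging the radius from [r] to [s] makes every sequence representing a point of the closed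
    [r]-ball lie in [uball s]. The shell this adds costs [h] in distance and [h] in mass, on top of
    the [h] of the approximation itself; hence [e = 2 * h]. *)
Lemma upmm_ball_approx r e : 0 <= r -> 0 < e -> exists2 s, r <= s &
  U [set n | (dGHPc (ball_pmm upmm r) (ball_pmm (X n) s) <= e%:E)%E].
Proof.
move=> r0 e0; have [h h0 he] : exists2 h, 0 < h & e = 2 * h.
  by exists (e / 2); [rewrite divr_gt0|lra].
have [s [rs shell_mass shell]] := upmm_thin_shell r0 h0; exists s; first exact: ltW.
apply: filterS (uball_approx (le_trans r0 (ltW rs)) h0) => n /=.
move=> [Z [f [g [ZM fI gI oo [XY YX mA]]]]].
have eX A : pushf (X := ball_pmm (X n) s) f A = msr (X n) (B s n `&` f @^-1` A).
  by rewrite /pushf /= setIAC setIid.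
have ball_uball x : ubounded x -> closed_ball (bpt upmm) r (urep x) -> uball s x.
  move=> bx [_ /=]; rewrite udist_base_rep ?udist_repr//.
  - by move=> xr; apply: udist_lt_uball => //; exact: le_lt_trans rs.
  - exact: ubounded_base.
  - exact: ubounded_rep.
have ball_ustd y : closed_ball (bpt upmm) r y -> ustd s y.
  move=> yr; have [[bY ry] _] := yr; exists y => //.
  by apply: ball_uball => //; rewrite ry.
have nbhd_mono (A : set (mcar Z)) d d' : d <= d' -> nbhd_eps A d `<=` nbhd_eps A d'.
  by move=> dd' z [a Aa za]; exists a => //; exact: lt_le_trans dd'.
have h_le : h <= e by rewrite he; lra.
have eL A : pushf (X := ball_pmm upmm r) g A =
    loeb U (ubounded `&` [set x | closed_ball (bpt upmm) r (urep x) /\ A (g (urep x))]).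
  congr loeb; apply/seteqP; split=> x [bx /=]; first by move=> [[]].
  by move=> [xr Ax]; split.
apply: (@dGHPc_le _ (ball_pmm upmm r) (ball_pmm (X n) s) Z g f) => //.
- by move=> x y [Dx _] [Dy _]; exact: gI.
- by move=> x y [Dx _] [Dy _]; exact: fI.
- by rewrite zdistC//; exact: le_trans h_le.
- move=> y yr; have [x xs xy] := YX y (ball_ustd y yr); exists x => //.
  by rewrite zdistC//; exact: lt_le_trans h_le.
- move=> x xs; have [y ys xy] := XY x xs; have [y' y'r yy'] := shell y ys.
  exists y' => //; have Dy := ustd_udom ys; have [Dy' _] := y'r.
  have := zdist_triangle ZM (g y) (f x) (g y'); rewrite gI// (zdistC ZM (g y')) he; lra.
move=> A cA; have [m1 m2] := mA A cA; rewrite !eX !eL; split.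
  apply: (@le_trans _ _ (loeb U (uball s `&` [set x | A (g (urep x))]))).
    by apply: (@le_loeb _ _ _) => x [bx [xr Ax]]; split=> //; exact: ball_uball.
  apply: le_trans m2 _; apply: leeD; last by rewrite lee_fin.
  have bI d : borelX n (B s n `&` f @^-1` nbhd_eps A d).
    have -> : B s n `&` f @^-1` nbhd_eps A d =
        B s n `&` (dom (X n) `&` f @^-1` nbhd_eps A d).
      by rewrite setIA; congr (_ `&` _); apply/esym/setIidl => x [].
    by apply: borelI; [exact: uball_borel|exact: (borel_preimage_nbhd ZM fI)].
  by apply: (le_bmeasure (@Xm n)) => // x [xs Ax]; split=> //; exact: nbhd_mono Ax.
apply: le_trans m1 _.
have -> : e%:E = (h%:E + h%:E)%E by rewrite -EFinD he; congr EFin; lra.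
rewrite addeA leeD2r//; set E := (X in (_ <= loeb U X + _)%E).
apply: (@le_trans _ _ (loeb U (E `|` (uball s `&` [set x | (r < udist ubase x)%R])))).
  apply: (@le_loeb _ _ _) => x [xs Ax]; have bx := uball_bounded xs.
  have [xr|rx] := leP (udist ubase x) r; last by right.
  left; split=> //; split; last exact: nbhd_mono Ax.
  split; first exact: udom_rep.
  rewrite /= udist_base_rep ?udist_repr//; [exact: ubounded_base|exact: ubounded_rep].
apply: le_trans (outer_measureU2 (loeb_measure ooU okX) _ _) _.
by apply: leeD.
Qed.

Lemma upmm_approx e : 0 < e -> U [set n | (dGHP (X n) upmm <= e%:E)%E].
Proof.
(* The parameter in [dGHP] must be at most [1]; approximation up to [d / 4] meets the strict bound
   [d / 2]. *)
move=> e0; pose d := Num.min e 1.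
have d0 : 0 < d by rewrite lt_min e0 ltr01.
have d1 : d <= 1 by rewrite ge_min lexx orbT.
have de : d <= e by rewrite ge_min lexx.
have d4 : 0 < d / 4 by rewrite divr_gt0.
have r0 : 0 <= d^-1 by rewrite invr_ge0 ltW.
have lt4 : ((d / 4)%:E < (d / 2)%:E)%E by rewrite lte_fin; lra.
have [s rs sU] := upmm_ball_approx r0 d4.
apply: filterS (filterI (uball_pmm_approx r0 d4) sU) => n /= [h1 h2].
rewrite /dGHP ge_min; apply/orP; right.
apply: le_trans (_ : (d%:E <= _)%E); last by rewrite lee_fin.
apply: ereal_inf_lbound; exists d => //; split; first by rewrite d0 d1.
rewrite gt_max; apply/andP; split.
  apply: le_lt_trans lt4; apply: le_trans h1; apply: ereal_inf_lbound.
  exists (ustd d^-1), (upush (uball d^-1)); split=> //.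
  - exact: uball_pmm_compact.
  - exact: uball_pmm_ge.
  - exact: uball_pmm_le.
apply: le_lt_trans lt4; apply: le_trans h2; apply: ereal_inf_lbound.
exists (B s n), (fun A => msr (X n) (A `&` B s n)); split=> //.
- apply: compact_ball_pmm => //; exact: le_trans rs.
- split=> [x [Dx xr]|A bA]; first by split=> //; lra.
  have AB := borel_subset bA; rewrite !setIidl// => x /AB[Dx xr]; split=> //; lra.
- split=> [x []//|A bA]; by rewrite setIidl//; exact: borel_subset bA.
Qed.

End Ultraproduct.

(** * Uniform bounds and the theorem *)

Section Precompactness.
Variable R : realType.
Implicit Types (X Y L : pmm R) (C : set (pmm R)).

Lemma compact_pmm_bcompact L : compact_pmm L -> bcompact_pmm L.
Proof.
move=> [okL [[_ cL] fL]]; have [LM [_ mL]] := okL; split=> // x r Dx.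
have oB := open_in_ball_compl r LM Dx.
split; last first.
  apply: le_lt_trans fL; apply: (le_bmeasure mL); [exact: borel_closed_ball|exact: borelT|].
  by move=> y [].
split=> [y []//|I V oV BV].
pose W (i : option I) := if i is Some j then V j else dom L `\` closed_ball x r.
have [||F finF FW] := cL _ W; first by case.
  move=> y Dy; have [yr|nyr] := pselect (closed_ball x r y); last by exists None.
  by have [i _ Vi] := BV y yr; exists (Some i).
exists (Some @^-1` F); first by apply: finite_preimage => // i j _ _ [].
move=> y yr; have [[i|] Fi] := FW y yr.1; first by exists i.
by case=> _ /(_ yr).
Qed.

(** A single monotone number bounds net size and mass together, the form to which
    [uniform_of_subsequence] applies. *)
Definition net_mass_bound (r e : R) X (N : nat) :=
  has_net X r e N /\ (msr X (closed_ball (bpt X) r) <= N%:R%:E)%E.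

Lemma net_mass_bound_mono r e X N M : (N <= M)%N ->
  net_mass_bound r e X N -> net_mass_bound r e X M.
Proof.
move=> NM [[c [cr cP]] mN]; split.
  by exists c; split=> // x /cP[i iN xi]; exists i => //; exact: leq_trans NM.
by apply: le_trans mN _; rewrite lee_fin ler_nat.
Qed.

Lemma bcompact_net_mass_bound L r e : bcompact_pmm L -> 0 <= r -> 0 < e ->
  exists N, net_mass_bound r e L N.
Proof.
move=> [[LM [Lo mL]] bcL] r0 e0; have [cB fB] := bcL _ r Lo.
have oB : closed_ball (bpt L) r (bpt L) by split=> //; rewrite (metxx LM).
have [N Nnet] := compact_in_net LM oB cB e0.
have [m mP] : exists m : nat, (msr L (closed_ball (bpt L) r) <= m%:R%:E)%E.
  move: fB; case: (msr L _) => [a _|//|_]; last by exists 0%N; rewrite leNye.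
  by exists (Num.bound `|a|); rewrite lee_fin (le_trans (ler_norm _))// ltW// archi_boundP.
exists (maxn N m); split.
  have [c [cr cP]] := Nnet; exists c; split=> // x /cP[i iN xi]; exists i => //.
  exact: leq_trans (leq_maxl N m).
by apply: le_trans mP _; rewrite lee_fin ler_nat leq_maxr.
Qed.

Lemma net_mass_bound_transfer X L (D : set (car L)) m (r s d e : R) N :
  pmm_ok X -> pmm_ok L -> 0 <= r -> r <= s -> d <= 2^-1 -> d <= e / 4 ->
  compact_pmm (sub_pmm D m) -> pmm_le D m (dom L) (msr L) ->
  (dGHPc (ball_pmm X s) (sub_pmm D m) < d%:E)%E ->
  net_mass_bound (r + 1) (e / 4) L N -> net_mass_bound r e X N.+1.
Proof.
move=> okX okL r0 rs d2 de cD DL dXD [netL massL].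
have [[c [cr cP]] mX] := net_mass_transfer okX okL r0 rs d2 cD DL dXD netL.
split.
  exists c; split=> // x /cP[i iN xi]; exists i; first exact: ltnW.
  by apply: lt_le_trans xi _; lra.
apply: le_trans mX _; rewrite -natr1 EFinD; exact: leeD.
Qed.

Lemma relcompact_GHP_bound C r e : (forall X, C X -> bcompact_pmm X) ->
  relcompact_GHP C -> 0 <= r -> 0 < e ->
  exists N, forall X, C X -> net_mass_bound r e X N.
Proof.
move=> bcC rcC r0 e0; apply: uniform_of_subsequence => [X N M|v Cv].
  exact: net_mass_bound_mono.
have [phi [L [phi_lt bcL cvL]]] := rcC v Cv; have [okL _] := bcL.
have [N NL] := bcompact_net_mass_bound bcL (addr_ge0 r0 ler01) (divr_gt0 e0 (ltr0Sn R 3)).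
exists phi, N.+1; split=> // K.
(* The first term excludes the default value [1] of [dGHP], the second makes the radius [t^-1]
   exceed [r], and the third keeps the error [t / 2] below [e / 4]. *)
pose d := Num.min 1 (Num.min (r + 1)^-1 (e / 4)).
have d0 : 0 < d by rewrite !lt_min ltr01 invr_gt0 divr_gt0// ltr_wpDl.
have [k Kk] := cvge0_frequently K d0 cvL.
rewrite /dGHP gt_min => /orP[|/ereal_inf_lt[_ [t [/andP[t0 t1] amax] <-] td]].
  by rewrite lte_fin ltNge ge_min lexx.
move: amax; rewrite gt_max => /andP[/ereal_inf_lt[_ [D [m [cD _ DL ->]]] dXD] _].
move: td; rewrite lte_fin !lt_min => /and3P[_ tr te].
have [okX _] := bcC _ (Cv (phi k)).
exists k => //; apply: (net_mass_bound_transfer okX okL r0 _ _ _ cD DL dXD NL); last 2 first.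
- lra.
- lra.
have r1 : 0 < r + 1 by rewrite ltr_wpDl.
have : (r + 1) < t^-1 by rewrite -[r + 1]invrK ltf_pV2 ?posrE ?invr_gt0.
by move=> /ltW; apply: le_trans; rewrite lerDl.
Qed.

Lemma relcompact_GHPc_bound C r e : (forall X, C X -> bcompact_pmm X) ->
  relcompact_GHPc [set ball_pmm X r | X in C] -> 0 <= r -> 0 < e ->
  exists N, forall X, C X -> net_mass_bound r e X N.
Proof.
move=> bcC rcC r0 e0; apply: uniform_of_subsequence => [X N M|v Cv].
  exact: net_mass_bound_mono.
have [n|phi [L [phi_lt cL cvL]]] := rcC (fun n => ball_pmm (v n) r); first by exists (v n).
have bcL := compact_pmm_bcompact cL; have [okL _] := bcL.
have [N NL] := bcompact_net_mass_bound bcL (addr_ge0 r0 ler01) (divr_gt0 e0 (ltr0Sn R 3)).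
exists phi, N.+1; split=> // K.
pose d := Num.min 2^-1 (e / 4).
have d0 : 0 < d by rewrite !lt_min invr_gt0 ltr0n divr_gt0.
have [k Kk dk] := cvge0_frequently K d0 cvL.
have [okX _] := bcC _ (Cv (phi k)).
(* Here the compact limit itself plays the role of the intermediate subspace in the transfer. *)
have eL : sub_pmm (dom L) (msr L) = L by case: L {cL cvL bcL okL NL dk}.
exists k => //; apply: (@net_mass_bound_transfer _ L (dom L) (msr L) r r d) => //; rewrite ?eL//.
- by rewrite ge_min lexx.
- by rewrite ge_min lexx orbT.
- by split.
Qed.

Lemma exists_free_ultrafilter :
  exists U : set_system nat, UltraFilter U /\ (\oo : set_system nat) `<=` U.
Proof. exact: ultraFilterLemma. Qed.

End Precompactness.

(** Both implications use uniform bounds at all radii. In the first, the limit for radius [r] is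
    [uball_pmm X U r]; in the second, the bounds at radius [t] come from the hypothesis at the same
    [t], and the one space [upmm v U] is the limit. *)
Theorem theorem3p28 (R : realType) (C : set (pmm R))
  (HC : forall X, C X -> bcompact_pmm X) :
  relcompact_GHP C <->
  (forall r : R, 0 <= r -> relcompact_GHPc [set ball_pmm X r | X in C]).
Proof.
have [U [UU ooU]] := exists_free_ultrafilter.
split=> [rcC r r0 v Cv|rcC v Cv].
  have /choice[X XP] n : exists X, C X /\ ball_pmm X r = v n.
    by have [X CX XE] := Cv n; exists X.
  have bcX n : bcompact_pmm (X n) by apply: HC; case: (XP n).
  have bnd := relcompact_GHP_bound HC rcC.
  have Xnet t e : 0 <= t -> 0 < e -> exists N, forall n, has_net (X n) t e N.
    move=> t0 e0; have [N NP] := bnd t e t0 e0; exists N => n.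
    by have [] := NP _ (XP n).1.
  have Xmass t : 0 <= t ->
      exists M : R, forall n, (msr (X n) (closed_ball (bpt (X n)) t) <= M%:E)%E.
    move=> t0; have [N NP] := bnd t 1 t0 ltr01; exists N%:R => n.
    by have [] := NP _ (XP n).1.
  have [||phi [phi_lt phi_cvg]] := @cvge0_subsequence R U
      (fun n => dGHPc (v n) (uball_pmm X U r)) _ ooU.
  - by move=> n; exact: dGHPc_ge0.
  - move=> e e0; apply: filterS (uball_pmm_approx bcX Xnet Xmass r0 e0) => n /=.
    by rewrite (XP n).2.
  exists phi, (uball_pmm X U r); split=> //.
  exact: (uball_pmm_compact ooU bcX Xnet Xmass r0).
have bcv n : bcompact_pmm (v n) by exact: HC.
have bnd t e (t0 : 0 <= t) := @relcompact_GHPc_bound R C t e HC (rcC t t0) t0.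
have vnet t e : 0 <= t -> 0 < e -> exists N, forall n, has_net (v n) t e N.
  by move=> t0 e0; have [N NP] := bnd t e t0 e0; exists N => n; have [] := NP _ (Cv n).
have vmass t : 0 <= t ->
    exists M : R, forall n, (msr (v n) (closed_ball (bpt (v n)) t) <= M%:E)%E.
  by move=> t0; have [N NP] := bnd t 1 t0 ltr01; exists N%:R => n; have [] := NP _ (Cv n).
have [||phi [phi_lt phi_cvg]] := @cvge0_subsequence R U (fun n => dGHP (v n) (upmm v U)) _ ooU.
- by move=> n; exact: dGHP_ge0.
- by move=> e e0; exact: (upmm_approx ooU bcv vnet vmass e0).
exists phi, (upmm v U); split=> //.
exact: (upmm_bcompact ooU bcv vnet vmass).
Qed.
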